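(* Let $A$ be a reduced Noetherian ring. Then the integral closure $A'$ of $A$ (in its total quotient ring) is perinormal.
   Context: All rings are commutative with unity. For a ring $A$, $\mathrm{Reg}(A)$ is the set of regular elements (non-zero-divisors) of $A$, and the total quotient ring $K$ of $A$ is the fraction ring of $A$ with denominators in $\mathrm{Reg}(A)$. An overring of $A$ is a ring $B$ with $A\subseteq B\subseteq K$. A ring extension $A\subseteq B$ satisfies going down if, whenever $P_1\subseteq P_2$ are prime ideals of $A$ and $Q_2$ is a prime ideal of $B$ with $Q_2\cap A=P_2$, there is a prime ideal $Q_1\subseteq Q_2$ of $B$ with $Q_1\cap A=P_1$. A GD-overring of $A$ is an overring $B$ of $A$ such that $A\subseteq B$ satisfies going down. A ring $A$ is perinormal if every GD-overring of $A$ is flat as an $A$-module. *)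

(* Defs.v *)
From HB Require Import structures.
From mathcomp Require Import all_boot all_algebra ring.
From mathcomp Require Import boolp classical_sets.

Set Implicit Arguments.
Unset Strict Implicit.
Unset Printing Implicit Defensive.

Import GRing.Theory.
Local Open Scope ring_scope.
Local Open Scope quotient_scope.
Local Open Scope classical_set_scope.

(* Rings are comPzRingType throughout, so that the zero ring is allowed.  This
   is why ideals and integrality are spelled out here: their versions in
   ring_quotient and mxpoly require 1 != 0. *)

Section Ideals.
Variable A : comPzRingType.
Implicit Types I P : set A.

Definition is_ideal I :=
  [/\ I 0, forall x y, I x -> I y -> I (x + y) & forall a x, I x -> I (a * x)].

Definition is_prime P :=
  [/\ is_ideal P, ~ P 1 & forall x y, P (x * y) -> P x \/ P y].

Definition finitely_generated I :=
  exists (n : nat) (g : 'I_n -> A),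
    I = [set x | exists c : 'I_n -> A, x = \sum_i c i * g i].

Definition noetherian := forall I, is_ideal I -> finitely_generated I.

Definition reduced := forall (x : A) (n : nat), x ^+ n = 0 -> x = 0.

End Ideals.

Arguments noetherian : clear implicits.
Arguments reduced : clear implicits.

Definition going_down (A B : comPzRingType) (f : {rmorphism A -> B}) :=
  forall P1 P2 : set A, is_prime P1 -> is_prime P2 -> P1 `<=` P2 ->
  forall Q2 : set B, is_prime Q2 -> f @^-1` Q2 = P2 ->
  exists Q1 : set B, [/\ is_prime Q1, Q1 `<=` Q2 & f @^-1` Q1 = P1].

Module TotalFrac.
Section TotalFrac.
Variable A : comPzRingType.

(* In a commutative ring, GRing.lreg s says that s is a non-zero-divisor. *)
Record ratio := Ratio { frac :> A * A; _ : `[< GRing.lreg frac.2 >] }.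

#[export] HB.instance Definition _ := [isSub for frac].
#[export] HB.instance Definition _ := [Choice of ratio by <:].

Implicit Types x y z : ratio.

Lemma denP x : GRing.lreg x.2.
Proof. by case: x => p /= /asboolP. Qed.

Lemma den1P (a : A) : `[< GRing.lreg (a, 1 : A).2 >].
Proof. by apply/asboolP; apply: lreg1. Qed.

Lemma denMP (a : A) x y : `[< GRing.lreg (a, x.2 * y.2).2 >].
Proof. by apply/asboolP; apply: lregM; apply: denP. Qed.

Lemma denNP (a : A) x : `[< GRing.lreg (a, x.2).2 >].
Proof. by apply/asboolP; apply: denP. Qed.

Definition equivf x y := x.1 * y.2 == y.1 * x.2.

Lemma equivf_refl : reflexive equivf.
Proof. by move=> x; rewrite /equivf. Qed.

Lemma equivf_sym : symmetric equivf.
Proof. by move=> x y; rewrite /equivf eq_sym. Qed.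

Lemma equivf_trans : transitive equivf.
Proof.
move=> y x z /eqP xy /eqP yz; apply/eqP; apply: (denP (x := y)).
by rewrite mulrCA mulrA xy mulrAC yz mulrAC [RHS]mulrC.
Qed.

Canonical equivf_equiv := EquivRel equivf equivf_refl equivf_sym equivf_trans.

Definition type := {eq_quot equivf}.

#[export] HB.instance Definition _ : EqQuotient _ equivf type := EqQuotient.on type.
#[export] HB.instance Definition _ := Choice.on type.

Lemma equivfP x y : reflect (x.1 * y.2 = y.1 * x.2) (x == y %[mod type]).
Proof. by rewrite eqmodE; apply: eqP. Qed.

Lemma reprE x : (repr (\pi_type x)).1 * x.2 = x.1 * (repr (\pi_type x)).2.
Proof. by apply/equivfP; rewrite reprK. Qed.

Definition embed (a : A) := Ratio (den1P a).
Definition addf x y := Ratio (denMP (x.1 * y.2 + y.1 * x.2) x y).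
Definition oppf x := Ratio (denNP (- x.1) x).
Definition mulf x y := Ratio (denMP (x.1 * y.1) x y).

Definition inj := lift_embed type embed.
Canonical inj_pi_morph := PiEmbed inj.

Definition add := lift_op2 type addf.
Lemma pi_add : {morph \pi : x y / addf x y >-> add x y}.
Proof.
move=> x y; unlock add; apply/eqP/equivfP => /=.
set x' := repr _; set y' := repr _.
have Ex : x'.1 * x.2 = x.1 * x'.2 := reprE x.
have Ey : y'.1 * y.2 = y.1 * y'.2 := reprE y.
rewrite !mulrDl; congr (_ + _).
  by rewrite mulrACA [RHS]mulrACA Ex [y.2 * _]mulrC.
rewrite [x'.2 * _]mulrC mulrACA -Ey [x.2 * y.2]mulrC [RHS]mulrACA.
by rewrite [x'.2 * _]mulrC.
Qed.
Canonical pi_add_morph := PiMorph2 pi_add.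

Definition opp := lift_op1 type oppf.
Lemma pi_opp : {morph \pi : x / oppf x >-> opp x}.
Proof.
by move=> x; unlock opp; apply/eqP/equivfP; rewrite /= !mulNr reprE.
Qed.
Canonical pi_opp_morph := PiMorph1 pi_opp.

Definition mul := lift_op2 type mulf.
Lemma pi_mul : {morph \pi : x y / mulf x y >-> mul x y}.
Proof.
move=> x y; unlock mul; apply/eqP/equivfP => /=.
by rewrite mulrACA -!reprE mulrACA.
Qed.
Canonical pi_mul_morph := PiMorph2 pi_mul.

Lemma ratio_eq x y : x.1 = y.1 -> x.2 = y.2 -> x = y.
Proof. move=> e1 e2; apply: val_inj.
by apply/pair_eqP; rewrite /= /pair_eq e1 e2 !eqxx. Qed.

Lemma addA : associative add.
Proof.
elim/quotW=> x; elim/quotW=> y; elim/quotW=> z; rewrite !piE.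
congr \pi; apply: ratio_eq; rewrite /= !mulrA // !mulrDl addrA.
by rewrite [y.1 * _ * _]mulrAC [z.1 * _ * _]mulrAC.
Qed.

Lemma addC : commutative add.
Proof.
elim/quotW=> x; elim/quotW=> y; rewrite !piE.
by congr \pi; apply: ratio_eq => /=; rewrite 1?addrC // mulrC.
Qed.

Lemma add0 : left_id (inj 0) add.
Proof.
elim/quotW=> x; rewrite !piE; congr \pi; apply: ratio_eq => /=.
  by rewrite mul0r add0r mulr1.
by rewrite mul1r.
Qed.

Lemma addN : left_inverse (inj 0) opp add.
Proof.
elim/quotW=> x; rewrite !piE; apply/eqP/equivfP => /=.
by rewrite mulNr addNr !mul0r.
Qed.

#[export] HB.instance Definition _ := GRing.isZmodule.Build type addA addC add0 addN.

Lemma mulA : associative mul.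
Proof.
elim/quotW=> x; elim/quotW=> y; elim/quotW=> z; rewrite !piE.
by congr \pi; apply: ratio_eq => /=; rewrite mulrA.
Qed.

Lemma mulC : commutative mul.
Proof.
elim/quotW=> x; elim/quotW=> y; rewrite !piE.
by congr \pi; apply: ratio_eq => /=; rewrite mulrC.
Qed.

Lemma mul1 : left_id (inj 1) mul.
Proof.
by elim/quotW=> x; rewrite !piE; congr \pi; apply: ratio_eq; rewrite /= mul1r.
Qed.

Lemma mulD : left_distributive mul add.
Proof.
elim/quotW=> x; elim/quotW=> y; elim/quotW=> z; rewrite !piE.
apply/eqP/equivfP => /=; ring.
Qed.

#[export] HB.instance Definition _ :=
  GRing.Zmodule_isComPzRing.Build type mulA mulC mul1 mulD.

Lemma inj_is_zmod_morphism : zmod_morphism inj.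
Proof.
move=> a b; change (inj (a - b) = add (inj a) (opp (inj b))).
by rewrite !piE; congr \pi; apply: ratio_eq; rewrite /= !mulr1.
Qed.

Lemma inj_is_monoid_morphism : monoid_morphism inj.
Proof.
split=> // a b; change (inj (a * b) = mul (inj a) (inj b)).
rewrite !piE.
by congr \pi; apply: ratio_eq; rewrite /= ?mulr1.
Qed.

#[export] HB.instance Definition _ :=
  GRing.isZmodMorphism.Build A type inj inj_is_zmod_morphism.
#[export] HB.instance Definition _ :=
  GRing.isMonoidMorphism.Build A type inj inj_is_monoid_morphism.

End TotalFrac.

Module Exports. HB.reexport. End Exports.
End TotalFrac.
HB.export TotalFrac.Exports.

Notation total_frac := TotalFrac.type.

Definition tofrac (A : comPzRingType) : {rmorphism A -> total_frac A} :=
  @TotalFrac.inj A.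
Arguments tofrac {A}.

Section TotalFracTheory.
Import TotalFrac.
Variable A : comPzRingType.

Lemma tofrac_inj : injective (tofrac : A -> total_frac A).
Proof.
move=> a b; rewrite /tofrac /= !piE => /eqP/equivfP /=.
by rewrite !mulr1.
Qed.

Lemma tofrac_unit (s : A) :
  GRing.lreg s -> exists y : total_frac A, tofrac s * y = 1.
Proof.
move=> s_reg; have sP : `[< GRing.lreg (1 : A, s).2 >] by apply/asboolP.
exists (\pi_(total_frac A) (Ratio sP)).
change (mul (inj s) (\pi_(total_frac A) (Ratio sP)) = inj 1).
rewrite !piE; apply/eqP/equivfP => /=.
by rewrite mul1r !mulr1 mul1r.
Qed.

Lemma tofrac_surj (x : total_frac A) :
  exists a s : A, GRing.lreg s /\ x * tofrac s = tofrac a.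
Proof.
elim/quotW: x => x; exists x.1, x.2; split; first exact: denP.
change (mul (\pi_(total_frac A) x) (inj x.2) = inj x.1).
by rewrite !piE; apply/eqP/equivfP; rewrite /= !mulr1.
Qed.

End TotalFracTheory.

Definition integral (A B : comPzRingType) (f : {rmorphism A -> B}) (x : B) :=
  exists (n : nat) (c : 'I_n -> A), x ^+ n + \sum_i f (c i) * x ^+ i = 0.

Section IntegralTheory.

Lemma integralE (A B : comNzRingType) (f : {rmorphism A -> B}) (x : B) :
  integral f x <-> integralOver f x.
Proof.
split=> [[n [c xc]]|[p p_mon /rootP px]].
  have sz : (size (\sum_i c i *: 'X^i : {poly A})%R < size ('X^n : {poly A})%R)%N.
    rewrite size_polyXn ltnS (leq_trans (size_sum _ _ _)) //.
    apply/bigmax_leqP => i _; rewrite (leq_trans (size_scale_leq _ _)) //.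
    by rewrite size_polyXn.
  exists ('X^n + \sum_i c i *: 'X^i).
    by rewrite monicE lead_coefDl // lead_coefXn.
  apply/rootP; rewrite rmorphD rmorph_sum /= map_polyXn hornerD hornerXn -[RHS]xc.
  congr (_ + _); rewrite horner_sum; apply: eq_bigr => i _.
  by rewrite map_polyZ map_polyXn hornerZ hornerXn.
have [n szp] : exists n, size p = n.+1.
  by exists (size p).-1; rewrite prednK // lt0n size_poly_eq0 monic_neq0.
have pn : p`_n = 1 by move/monicP: p_mon; rewrite /lead_coef szp.
exists n, (fun i => p`_i); rewrite -[RHS]px (@horner_coef_wide _ n.+1).
  rewrite big_ord_recr /= coef_map /= pn rmorph1 mul1r addrC; congr (_ + _).
  by apply: eq_bigr => i _; rewrite coef_map.
by rewrite -szp size_poly.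
Qed.

Variables (A B : comPzRingType) (f : {rmorphism A -> B}).

Lemma integral_trivial (x : B) : (1 : B) = 0 -> integral f x.
Proof. by move=> B1; exists 0, (fun=> 0); rewrite big_ord0 addr0 expr0. Qed.

Lemma integral_image a : integral f (f a).
Proof.
by exists 1, (fun=> - a); rewrite big_ord1 expr0 mulr1 expr1 rmorphN subrr.
Qed.

Lemma integral_subring_closed : subring_closed [pred x | `[< integral f x >]].
Proof.
have [B1|B1] := eqVneq (1 : B) 0.
  have intT x : `[< integral f x >] by apply/asboolP/integral_trivial.
  by split=> [|x y _ _|x y _ _]; apply: intT.
have A1 : (1 : A) != 0.
  by apply: contra B1 => /eqP e; rewrite -(rmorph1 f) e rmorph0.
pose A' : comNzRingType :=
  HB.pack (GRing.ComPzRing.sort A) (GRing.PzSemiRing_isNonZero.Build A A1).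
pose B' : comNzRingType :=
  HB.pack (GRing.ComPzRing.sort B) (GRing.PzSemiRing_isNonZero.Build B B1).
pose f' : {rmorphism A' -> B'} :=
  HB.pack (f : A' -> B') (GRing.isZmodMorphism.Build A' B' f (rmorphB f))
    (GRing.isMonoidMorphism.Build A' B' f (rmorph1 f, rmorphM f)).
have intE (x : B) : integral f x <-> integralOver f' x := integralE f' x.
split=> [|x y /asboolP/intE ix /asboolP/intE iy|x y /asboolP/intE ix /asboolP/intE iy];
  apply/asboolP; apply: (iffRL (intE _)).
- exact: integral1.
- exact: integral_sub.
- exact: integral_mul.
Qed.

End IntegralTheory.

Record integral_closure (A : comPzRingType) := IntegralClosure {
  ic_val :> total_frac A;
  _ : ic_val \in [pred x | `[< integral tofrac x >]] }.

Section IntegralClosure.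
Variable A : comPzRingType.

HB.instance Definition _ := [isSub of integral_closure A for @ic_val A].
HB.instance Definition _ := [Choice of integral_closure A by <:].
HB.instance Definition _ := GRing.SubChoice_isSubComPzRing.Build
  (total_frac A) _ (integral_closure A)
  (integral_subring_closed (@tofrac A)).

End IntegralClosure.

Definition restrict_scalars (A B : comPzRingType) (f : {rmorphism A -> B})
  : Type := B.

Section RestrictScalars.
Variables (A B : comPzRingType) (f : {rmorphism A -> B}).

HB.instance Definition _ := GRing.Zmodule.on (restrict_scalars f).

Let scale (a : A) (b : restrict_scalars f) : restrict_scalars f :=
  f a * (b : B).

Let scaleA a b v : scale a (scale b v) = scale (a * b) v.
Proof. by rewrite /scale rmorphM mulrA. Qed.

Let scale1 : left_id 1 scale.
Proof. by move=> v; rewrite /scale rmorph1 mul1r. Qed.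

Let scaleDr : right_distributive scale +%R.
Proof. by move=> a u v; rewrite /scale mulrDr. Qed.

Let scaleDl v : {morph scale^~ v : a b / a + b}.
Proof. by move=> a b; rewrite /scale rmorphD mulrDl. Qed.

HB.instance Definition _ := GRing.Zmodule_isLmodule.Build A
  (restrict_scalars f) scaleA scale1 scaleDr scaleDl.

End RestrictScalars.

(* The tensor product of M and N over A.  A formal sum of pure tensors is a
   sequence of pairs, and tensor_eq is the least congruence for concatenation
   that makes (m, n) |-> [:: (m, n)] an A-balanced biadditive map into a
   commutative monoid; the quotient is then automatically an abelian group. *)
Module Tensor.
Section Tensor.
Variables (A : comPzRingType) (M N : lmodType A).

Local Notation fsum := (seq (M * N)).
Implicit Types s t u : fsum.

Inductive tensor_eq : fsum -> fsum -> Prop :=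
| TensorRefl s : tensor_eq s s
| TensorSym s t : tensor_eq s t -> tensor_eq t s
| TensorTrans s t u : tensor_eq s t -> tensor_eq t u -> tensor_eq s u
| TensorCat s s' t t' :
    tensor_eq s s' -> tensor_eq t t' -> tensor_eq (s ++ t) (s' ++ t')
| TensorComm s t : tensor_eq (s ++ t) (t ++ s)
| TensorZero n : tensor_eq [:: (0, n)] [::]
| TensorDl m m' n : tensor_eq [:: (m + m', n)] [:: (m, n); (m', n)]
| TensorDr m n n' : tensor_eq [:: (m, n + n')] [:: (m, n); (m, n')]
| TensorZ a m n : tensor_eq [:: (a *: m, n)] [:: (m, a *: n)].

Definition tensor_eqb s t := `[< tensor_eq s t >].

Lemma tensor_eqb_refl : reflexive tensor_eqb.
Proof. by move=> s; apply/asboolP/TensorRefl. Qed.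

Lemma tensor_eqb_sym : symmetric tensor_eqb.
Proof. by move=> s t; apply/asboolP/asboolP => /TensorSym. Qed.

Lemma tensor_eqb_trans : transitive tensor_eqb.
Proof.
by move=> t s u /asboolP st /asboolP tu; apply/asboolP/(TensorTrans st tu).
Qed.

Canonical tensor_equiv :=
  EquivRel tensor_eqb tensor_eqb_refl tensor_eqb_sym tensor_eqb_trans.

Definition type := {eq_quot tensor_eqb}.

#[export] HB.instance Definition _ : EqQuotient _ tensor_eqb type := EqQuotient.on type.
#[export] HB.instance Definition _ := Choice.on type.

Lemma piP s t : \pi_type s = \pi_type t <-> tensor_eq s t.
Proof.
split=> [/eqP|st]; first by rewrite eqmodE => /asboolP.
by apply/eqP; rewrite eqmodE; apply/asboolP.
Qed.

Lemma repr_eq s : tensor_eq (repr (\pi_type s)) s.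
Proof. by apply/piP; rewrite reprK. Qed.

Definition scale_sum (a : A) s := [seq (a *: p.1, p.2) | p <- s].

Lemma scale_sum_eq a s t :
  tensor_eq s t -> tensor_eq (scale_sum a s) (scale_sum a t).
Proof.
elim=> {s t} [s|s t _ /TensorSym //|s t u _ st _ tu|s s' t t' _ st _ tu|s t|n|m m' n|m n n'|b m n].
- exact: TensorRefl.
- exact: TensorTrans st tu.
- by rewrite /scale_sum !map_cat; apply: TensorCat.
- by rewrite /scale_sum !map_cat; apply: TensorComm.
- by rewrite /= scaler0; apply: TensorZero.
- by rewrite /= scalerDr; apply: TensorDl.
- exact: TensorDr.
- by rewrite /= scalerA mulrC -scalerA; apply: TensorZ.
Qed.

Definition zero : type := \pi_type [::].
Definition add (x y : type) : type := \pi_type (repr x ++ repr y).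
Definition scale (a : A) (x : type) : type := \pi_type (scale_sum a (repr x)).
Definition opp (x : type) : type := scale (-1) x.

Lemma add_pi s t : add (\pi_type s) (\pi_type t) = \pi_type (s ++ t).
Proof. by apply/piP/TensorCat; apply: repr_eq. Qed.

Lemma scale_pi a s : scale a (\pi_type s) = \pi_type (scale_sum a s).
Proof. by apply/piP/scale_sum_eq/repr_eq. Qed.

Lemma addA : associative add.
Proof.
elim/quotW=> s; elim/quotW=> t; elim/quotW=> u.
by rewrite (add_pi t u) (add_pi s (t ++ u)) (add_pi s t) (add_pi _ u) catA.
Qed.

Lemma addC : commutative add.
Proof.
by elim/quotW=> s; elim/quotW=> t; rewrite (add_pi s t) (add_pi t s); apply/piP/TensorComm.
Qed.

Lemma add0 : left_id zero add.
Proof. by elim/quotW=> s; rewrite (add_pi [::] s). Qed.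

Lemma scale0 x : scale 0 x = zero.
Proof.
elim/quotW: x => s; rewrite scale_pi; apply/piP.
elim: s => [|[m n] s IHs]; first exact: TensorRefl.
rewrite /= scale0r; exact: TensorCat (TensorZero n) IHs.
Qed.

Lemma scaleDl x : {morph scale^~ x : a b / a + b >-> add a b}.
Proof.
move=> a b; elim/quotW: x => s; rewrite (scale_pi _ s) (scale_pi a s) (scale_pi b s).
rewrite add_pi; apply/piP.
elim: s => [|[m n] s IHs]; first exact: TensorRefl.
rewrite /= scalerDl -cat1s -[_ :: scale_sum b s]cat1s -cat_cons.
rewrite -[_ :: scale_sum a s]cat1s.
apply: TensorTrans (TensorCat (TensorDl _ _ _) IHs) _.
rewrite -[[:: _; _]]cat1s -!catA; apply: TensorCat; first exact: TensorRefl.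
rewrite !catA; apply: TensorCat; last exact: TensorRefl.
exact: TensorComm.
Qed.

Lemma scale1 : left_id 1 scale.
Proof.
elim/quotW=> s; rewrite scale_pi /scale_sum -[X in _ = \pi_type X]map_id.
by congr \pi; apply: eq_map => -[m n]; rewrite /= scale1r.
Qed.

Lemma addN : left_inverse zero opp add.
Proof.
move=> x; rewrite /opp -{2}[x]scale1 -scaleDl addNr; exact: scale0.
Qed.

#[export] HB.instance Definition _ := GRing.isZmodule.Build type addA addC add0 addN.

Lemma scaleA a b x : scale a (scale b x) = scale (a * b) x.
Proof.
elim/quotW: x => s.
rewrite (scale_pi b s) (scale_pi a _) (scale_pi _ s) /scale_sum -map_comp.
by congr \pi; apply: eq_map => -[m n]; rewrite /= scalerA.
Qed.

Lemma scaleDr : right_distributive scale +%R.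
Proof.
move=> a; elim/quotW=> s; elim/quotW=> t.
change (scale a (add (\pi_type s) (\pi_type t)) = add (scale a (\pi_type s)) (scale a (\pi_type t))).
by rewrite (scale_pi a s) (scale_pi a t) !add_pi scale_pi /scale_sum map_cat.
Qed.

#[export] HB.instance Definition _ :=
  GRing.Zmodule_isLmodule.Build A type scaleA scale1 scaleDr scaleDl.

Definition pure (m : M) (n : N) : type := \pi_type [:: (m, n)].

End Tensor.

Section Map.
Variables (A : comPzRingType) (M N N' : lmodType A) (u : {linear N -> N'}).

Definition map_sum (s : seq (M * N)) := [seq (p.1, u p.2) | p <- s].

Lemma map_sum_eq s t : tensor_eq s t -> tensor_eq (map_sum s) (map_sum t).
Proof.
elim=> {s t} [s|s t _ /TensorSym //|s t w _ st _ tw|s s' t t' _ st _ tw|s t|n|m m' n|m n n'|b m n].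
- exact: TensorRefl.
- exact: TensorTrans st tw.
- by rewrite /map_sum !map_cat; apply: TensorCat.
- by rewrite /map_sum !map_cat; apply: TensorComm.
- exact: TensorZero.
- exact: TensorDl.
- by rewrite /= linearD; apply: TensorDr.
- by rewrite /= linearZ; apply: TensorZ.
Qed.

(* The map id_M (x) u. *)
Definition map (x : type M N) : type M N' := \pi_(type M N') (map_sum (repr x)).

Lemma map_pi s : map (\pi_(type M N) s) = \pi_(type M N') (map_sum s).
Proof. by apply/piP/map_sum_eq/repr_eq. Qed.

Lemma map_pure m n : map (pure m n) = pure m (u n).
Proof. by rewrite /pure map_pi. Qed.

Lemma map_is_linear : linear map.
Proof.
move=> a; elim/quotW=> s; elim/quotW=> t.
change (map (add (scale a (\pi_(type M N) s)) (\pi_(type M N) t)) =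
  add (scale a (map (\pi_(type M N) s))) (map (\pi_(type M N) t))).
rewrite (scale_pi a s) (map_pi s) (map_pi t) scale_pi !add_pi map_pi.
by rewrite /map_sum /scale_sum map_cat -!map_comp.
Qed.

HB.instance Definition _ := GRing.isLinear.Build A (type M N) (type M N') _ map
  map_is_linear.

End Map.

Section Universal.
Variables (A : comPzRingType) (M N P : lmodType A) (b : M -> N -> P).
Hypothesis bDl : forall n, {morph b^~ n : m m' / m + m'}.
Hypothesis bDr : forall m, {morph b m : n n' / n + n'}.
Hypothesis bZl : forall a m n, b (a *: m) n = a *: b m n.
Hypothesis bZr : forall a m n, b m (a *: n) = a *: b m n.

Let ev (s : seq (M * N)) := \sum_(p <- s) b p.1 p.2.

Let ev_eq s t : tensor_eq s t -> ev s = ev t.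
Proof.
rewrite /ev.
elim=> {s t} [//|//|s t w _ -> _ ->//|s s' t t' _ st _ tw|s t|n|m m' n|m n n'|a m n].
- by rewrite !big_cat /= st tw.
- by rewrite !big_cat /= addrC.
- by rewrite big_seq1 big_nil /= -[0]/(0 : M) -(scale0r 0) bZl scale0r.
- by rewrite !big_cons big_nil /= bDl !addr0.
- by rewrite !big_cons big_nil /= bDr !addr0.
- by rewrite !big_seq1 /= bZl bZr.
Qed.

Lemma pi_sum s :
  \pi_(type M N) s = \sum_(p <- s) pure p.1 p.2.
Proof.
elim: s => [|[m n] s IHs]; first by rewrite big_nil.
by rewrite big_cons -IHs; rewrite -[RHS]/(add _ _) /pure add_pi.
Qed.

Lemma universal :
  exists h : {linear type M N -> P}, (forall m n, h (pure m n) = b m n) /\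
    forall g : {linear type M N -> P},
      (forall m n, g (pure m n) = b m n) -> g =1 h.
Proof.
pose h (x : type M N) := ev (repr x).
have h_pi s : h (\pi_(type M N) s) = ev s by apply/ev_eq/repr_eq.
have h_lin : linear h.
  move=> a; elim/quotW=> s; elim/quotW=> t.
  change (h (add (scale a (\pi_(type M N) s)) (\pi_(type M N) t)) =
    a *: h (\pi_(type M N) s) + h (\pi_(type M N) t)).
  rewrite (scale_pi a s) add_pi (h_pi s) (h_pi t) h_pi /ev big_cat /=.
  by rewrite big_map scaler_sumr; congr (_ + _); apply: eq_bigr => p _; rewrite bZl.
pose hL : {linear type M N -> P} :=
  HB.pack h (GRing.isLinear.Build A (type M N) P _ h h_lin).
exists hL; split=> [m n|g gE]; first by rewrite /= /pure h_pi /ev big_seq1.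
elim/quotW=> s; rewrite /= h_pi pi_sum linear_sum.
by apply: eq_bigr => -[m n] _; rewrite gE.
Qed.

End Universal.

Module Exports. HB.reexport. End Exports.
End Tensor.
HB.export Tensor.Exports.

Arguments Tensor.map {A} M {N N'} u x.

Definition flat (A : comPzRingType) (M : lmodType A) :=
  forall (N N' : lmodType A) (u : {linear N -> N'}),
  injective u -> injective (Tensor.map M u).

(* Up to isomorphism, f is the inclusion A <= B of rings A <= B <= total_frac A.
   The map f is then injective, because tofrac is. *)
Definition is_overring (A B : comPzRingType) (f : {rmorphism A -> B}) :=
  exists2 g : {rmorphism B -> total_frac A},
    injective g & forall a, g (f a) = tofrac a.

Definition perinormal (A : comPzRingType) :=
  forall (B : comPzRingType) (f : {rmorphism A -> B}),
  is_overring f -> going_down f -> flat (restrict_scalars f).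

(* Main.v *)
(** Let [D] be the integral closure of [A] in its total quotient ring [K], let
    [B] be a GD-overring, [b] in [B], [Q] a prime of [B] and [P] its trace on
    [D].  Flatness follows once some [d] outside [P] satisfies [d b] in [D].
    If there is none, it suffices to find a prime [p] of [D] inside [P] and
    [c] in [p] such that [c b] lies in [D] but not in [p]: going down lifts [p]
    to a prime of [B], which contains [c], hence [c b], a contradiction.

    To find [p], replace [b] by a multiple so that the [a] in [A] with
    [a b] in the localization [V] of [D] form a prime [m] of [A] and
    [m b] is contained in a finite subalgebra [A1] of [D].  Let [E] be the
    subring of [V] of elements that powers of elements of [m] carry into [A1],
    up to denominators outside [m].  By an argument of Matijevic extending
    Krull-Akizuki, [E] modulo a regular element of [m] is finite after
    localization at [m], so one may choose [e] in [E] for which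
    [n = {y in E | y e b in V}] is maximal among proper ideals of this form, hence
    prime.  Then [n e b] lies in [E], but not in [n], for otherwise [e b] would
    be integral over [V], which is integrally closed.  A prime of [D] over
    [n], chosen disjoint from the complement of [P], is the required [p]. *)
From mathcomp Require Import all_boot all_algebra.
From mathcomp Require Import boolp classical_sets ring.
Require Import Defs.

Set Implicit Arguments.
Unset Strict Implicit.
Unset Printing Implicit Defensive.

Import GRing.Theory.
Local Open Scope ring_scope.
Local Open Scope quotient_scope.
Local Open Scope classical_set_scope.

(** * Primes avoiding a multiplicative set *)

(** An ideal maximal among those that contain [I] and avoid [W] is prime. *)
Lemma prime_disjoint (R : comPzRingType) (I W : set R) :
  is_ideal I -> W 1 -> (forall x y, W x -> W y -> W (x * y)) ->
  (forall x, I x -> ~ W x) ->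
  exists p, [/\ is_prime p, I `<=` p & forall x, p x -> ~ W x].
Proof.
move=> idI W1 WM IW.
pose ok J := [/\ is_ideal J, I `<=` J & forall x, J x -> ~ W x].
have okI : ok I by split.
have [|M [PM maxM]] := @Zorn_bigcup R [set J | J = set0 \/ ok J].
  move=> F FP Ftot.
  have [[J [FJ okJ]]|noJ] := pselect (exists J, F J /\ ok J); last first.
    left; apply/seteqP; split=> // x [J FJ Jx].
    by case: (FP J FJ) => [J0|okJ]; [rewrite J0 in Jx | apply: noJ; exists J].
  right; split.
  - have [[J0 _ _] _ _] := okJ; split; first by exists J.
    + move=> x y [X FX Xx] [Y FY Yy].
      have [XY|YX] := Ftot X Y FX FY.
        exists Y => //; case: (FP Y FY) => [Y0|[[_ + _] _ _]]; first by rewrite Y0 in Yy.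
        by apply=> //; apply: XY.
      exists X => //; case: (FP X FX) => [X0|[[_ + _] _ _]]; first by rewrite X0 in Xx.
      by apply=> //; apply: YX.
    + move=> a x [X FX Xx]; exists X => //.
      case: (FP X FX) => [X0|[[_ _ +] _ _]]; first by rewrite X0 in Xx.
      exact.
  - by have [_ IJ _] := okJ; move=> x Ix; exists J => //; apply: IJ.
  - move=> x [X FX Xx]; case: (FP X FX) => [X0|[_ _]]; first by rewrite X0 in Xx.
    exact.
have [[M0 MD MM] IM MW] : ok M.
  case: PM => // M0; exfalso; apply: (maxM I); last by right.
  rewrite M0; split=> // /(_ 0); apply; by case: idI.
exists M; split=> //; split=> //; first by move/MW.
move=> x y Mxy; apply: contrapT => /not_orP[Mx My].
(* By maximality, adjoining [z] to [M] makes it meet [W]; the product of two such witnesses lies in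
   both [M] and [W]. *)
have ext z : ~ M z -> exists a u, M u /\ W (a * z + u).
  move=> Mz; apply: contrapT => no.
  pose N := [set w | exists a u, M u /\ w = a * z + u].
  apply: (maxM N).
    split; last by move/(_ z) => NM; apply/Mz/NM; exists 1, 0; rewrite mul1r addr0.
    by move=> u Mu; exists 0, u; rewrite mul0r add0r.
  right; split.
  - split; first by exists 0, 0; rewrite mul0r addr0.
      move=> _ _ [a [u [Mu ->]]] [c [v [Mv ->]]]; exists (a + c), (u + v).
      by split; [apply: MD | ring].
    move=> a _ [c [v [Mv ->]]]; exists (a * c), (a * v).
    by split; [apply: MM | ring].
  - by move=> w /IM Mw; exists 0, w; rewrite mul0r add0r.
  - by move=> _ [a [u [Mu ->]]] Ww; apply: no; exists a, u.
have [a [u [Mu Wu]]] := ext x Mx; have [c [v [Mv Wv]]] := ext y My.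
apply: (MW ((a * x + u) * (c * y + v))); last exact: WM.
rewrite (_ : _ * _ = (a * c) * (x * y) + ((a * x + u) * v + (c * y) * u)); last by ring.
by apply: (MD); [apply: (MM) | apply: (MD); apply: (MM)].
Qed.

(** * Submodules of an algebra over a Noetherian ring *)

Section Submodules.
Variables (A K : comPzRingType) (phi : {rmorphism A -> K}).
Implicit Types (X Y Z : set K) (l : seq K).

Definition submod X :=
  [/\ X 0, forall y z, X y -> X z -> X (y + z) &
      forall a y, X y -> X (phi a * y)].

Definition subalg X :=
  [/\ submod X, X 1 & forall y z, X y -> X z -> X (y * z)].

(** As an intersection of submodules, a span is bounded by exhibiting one submodule that contains
    the generators. *)
Definition lspan l : set K :=
  [set z | forall X, submod X -> (forall g, g \in l -> X g) -> X z].

Definition noeth_mod X :=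
  forall Y, submod Y -> Y `<=` X ->
  exists l, (forall g, g \in l -> Y g) /\ Y `<=` lspan l.

Lemma submod_lspan l : submod (lspan l).
Proof.
split.
- by move=> X [].
- by move=> y z ly lz X XM Xl; case: (XM) => _ + _; apply; [apply: ly | apply: lz].
- by move=> a y ly X XM Xl; case: (XM) => _ _; apply; apply: ly.
Qed.

Lemma mem_lspan l g : g \in l -> lspan l g.
Proof. by move=> lg X _; apply. Qed.

Lemma lspan_sub l X : submod X -> (forall g, g \in l -> X g) -> lspan l `<=` X.
Proof. by move=> XM Xl z; apply. Qed.

Lemma submodB X y z : submod X -> X y -> X z -> X (y - z).
Proof.
move=> [_ XD XZ] Xy Xz; apply: XD => //.
by rewrite -mulN1r -(rmorph1 phi) -rmorphN; apply: XZ.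
Qed.

Lemma submod_sum (I : Type) (r : seq I) (P : pred I) (F : I -> K) X :
  submod X -> (forall i, P i -> X (F i)) -> X (\sum_(i <- r | P i) F i).
Proof. by move=> [X0 XD _] XF; apply: big_ind. Qed.

Lemma submod_mul X z : submod X -> submod [set y | X (z * y)].
Proof.
move=> [X0 XD XZ]; split=> /= [|y w Xy Xw|a y Xy].
- by rewrite mulr0.
- by rewrite mulrDr; apply: XD.
- by rewrite mulrCA; apply: XZ.
Qed.

Lemma submodI X Y : submod X -> submod Y -> submod (X `&` Y).
Proof.
move=> [X0 XD XZ] [Y0 YD YZ]; split=> //.
- by move=> y z [? ?] [? ?]; split; [apply: XD | apply: YD].
- by move=> a y [? ?]; split; [apply: XZ | apply: YZ].
Qed.

Lemma subalgX X y k : subalg X -> X y -> X (y ^+ k).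
Proof.
by move=> [_ X1 XM] Xy; elim: k => [|k IH]; rewrite ?expr0 // exprS; apply: XM.
Qed.

Lemma noeth_modS X Y : X `<=` Y -> noeth_mod Y -> noeth_mod X.
Proof. by move=> XY nY Z ZM ZX; apply: nY => // z /ZX /XY. Qed.

Hypothesis noethA : noetherian A.

(** Induction on [l]: a submodule is generated by its part in [lspan l] together with lifts of
    generators of the ideal of its coefficients at [g]. *)
Lemma noeth_lspan l : noeth_mod (lspan l).
Proof.
elim: l => [|g l IH] Y YM Yl.
  exists [::]; split=> [g|y /Yl ly X [X0 _ _] _]; first by rewrite in_nil.
  suff -> : y = 0 by [].
  apply: (ly [set 0]) => //; split=> //= [u v -> ->|a u ->]; by rewrite ?addr0 ?mulr0.
have [l1 [Yl1 gen1]] := IH (Y `&` lspan l) (submodI YM (submod_lspan l)) (fun _ => @proj2 _ _).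
pose I := [set a | exists2 z, lspan l z & Y (phi a * g + z)].
have [l0 lD lZ] := submod_lspan l; have [Y0 YD YZ] := YM.
have idI : is_ideal I.
  split.
  - by exists 0 => //; rewrite rmorph0 mul0r addr0.
  - move=> a c [z lz Yz] [w lw Yw]; exists (z + w); first exact: lD.
    by rewrite rmorphD mulrDl addrACA; apply: YD.
  - move=> a c [z lz Yz]; exists (phi a * z); first exact: lZ.
    by rewrite rmorphM -mulrA -mulrDr; apply: YZ.
have [n [h Ih]] := noethA idI.
have Ihi i : I (h i).
  rewrite Ih; exists (fun j => (j == i)%:R); rewrite (bigD1 i) //= eqxx mul1r.
  by rewrite big1 ?addr0 // => j /negPf ->; rewrite mul0r.
have /choice [w wP] i : exists w, lspan l w /\ Y (phi (h i) * g + w).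
  by have [w lw Yw] := Ihi i; exists w.
pose l2 := [seq phi (h i) * g + w i | i <- enum 'I_n].
exists (l1 ++ l2); split.
  move=> y; rewrite mem_cat => /orP[/Yl1 []//|/mapP[i _ ->]].
  by case: (wP i).
move=> y Yy.
have [a [z [lz yE]]] : exists a z, lspan l z /\ y = phi a * g + z.
  apply: (Yl y Yy [set y | exists a z, lspan l z /\ y = phi a * g + z]).
    split=> /=.
    - by exists 0, 0; rewrite rmorph0 mul0r addr0.
    - move=> _ _ [a [u [lu ->]]] [c [v [lv ->]]]; exists (a + c), (u + v).
      by split; [apply: lD | rewrite rmorphD; ring].
    - move=> a _ [c [v [lv ->]]]; exists (a * c), (phi a * v).
      by split; [apply: lZ | rewrite rmorphM; ring].
  move=> u; rewrite inE => /orP[/eqP ->|lu].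
    by exists 1, 0; rewrite rmorph1 mul1r addr0.
  by exists 0, u; split; [apply: mem_lspan | rewrite rmorph0 mul0r add0r].
have : I a by exists z; rewrite // -yE.
rewrite Ih => -[c aE].
pose y2 := \sum_i phi (c i) * (phi (h i) * g + w i).
have y2E : y2 = phi a * g + \sum_i phi (c i) * w i.
  rewrite aE rmorph_sum mulr_suml -big_split /=; apply: eq_bigr => i _.
  by rewrite rmorphM; ring.
move=> X XM Xl; have [X0 XD XZ] := XM.
rewrite -[y](subrK y2); apply: XD.
  suff y12 : (Y `&` lspan l) (y - y2).
    by apply: (gen1 _ y12 X XM) => u lu; apply: (Xl); rewrite mem_cat lu.
  split.
    apply: submodB => //; apply: (@submod_sum _ _ _ _ Y) => // i _.
    by apply: YZ; case: (wP i).
  rewrite yE y2E opprD addrACA subrr add0r; apply: (@submodB (lspan l)) => //.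
  by apply: (@submod_sum _ _ _ _ (lspan l)) => [|i _]; [exact: submod_lspan | apply: lZ; case: (wP i)].
apply: (@submod_sum _ _ _ _ X) => // i _; apply: XZ; apply: Xl.
by rewrite mem_cat; apply/orP; right; apply/mapP; exists i; rewrite ?mem_enum.
Qed.

(** The union of a chain in [F] is finitely generated, hence equal to a member of the chain, so
    Zorn's lemma applies. *)
Lemma noeth_mod_max X (F : set (set K)) :
  noeth_mod X -> (exists Y, F Y) -> (forall Y, F Y -> submod Y /\ Y `<=` X) ->
  exists M, F M /\ forall Y, F Y -> M `<=` Y -> Y `<=` M.
Proof.
move=> nX [Y0 FY0] FX.
have [|M [PM maxM]] := @Zorn_bigcup K [set Y | Y = set0 \/ F Y].
  move=> C CP Ctot.
  have [[J [CJ FJ]]|noJ] := pselect (exists J, C J /\ F J); last first.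
    left; apply/seteqP; split=> // x [J CJ Jx].
    by case: (CP J CJ) => [J0|FJ]; [rewrite J0 in Jx | apply: noJ; exists J].
  right; set U := \bigcup_(_ in _) _.
  have CF Y y : C Y -> Y y -> F Y.
    by move=> CY Yy; case: (CP Y CY) => // Y00; rewrite Y00 in Yy.
  have UM : submod U.
    split.
    - by exists J => //; case: (FX J FJ) => -[].
    - move=> x y [Y CY Yx] [Z CZ Zy].
      have [YZ|ZY] := Ctot Y Z CY CZ.
        exists Z => //; have [[_ + _] _] := FX Z (CF Z y CZ Zy).
        by apply=> //; apply: YZ.
      exists Y => //; have [[_ + _] _] := FX Y (CF Y x CY Yx).
      by apply=> //; apply: ZY.
    - move=> a y [Y CY Yy]; exists Y => //.
      by have [[_ _ +] _] := FX Y (CF Y y CY Yy); apply.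
  have UX : U `<=` X by move=> y [Y CY Yy]; have [_] := FX Y (CF Y y CY Yy); apply.
  have [l [lU Ul]] := nX U UM UX.
  have [Z [CZ FZ lZ]] : exists Z, [/\ C Z, F Z & forall g, g \in l -> Z g].
    elim: l lU {Ul} => [|g l IH] lU; first by exists J.
    have [|Z [CZ FZ lZ]] := IH; first by move=> u lu; apply: lU; rewrite inE lu orbT.
    have [Y CY Yg] := lU g (mem_head g l).
    have [YZ|ZY] := Ctot Y Z CY CZ.
      by exists Z; split=> // u; rewrite inE => /orP[/eqP ->|]; [apply: YZ | apply: lZ].
    exists Y; split=> //; first exact: CF Yg.
    by move=> u; rewrite inE => /orP[/eqP ->//|/lZ/ZY].
  rewrite (_ : U = Z) //; apply/seteqP; split=> [y /Ul ly|y Zy]; last by exists Z.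
  by apply: ly lZ; case: (FX Z FZ).
have FM : F M.
  case: PM => // M0; exfalso; apply: (maxM Y0); last by right.
  rewrite M0; split=> // /(_ 0); apply.
  by case: (FX Y0 FY0) => -[].
exists M; split=> // Y FY MY; apply: contrapT => YM.
by apply: (maxM Y); [split | right].
Qed.

End Submodules.

Lemma noetherian_max (A : comPzRingType) (F : set (set A)) :
  noetherian A -> (exists I, F I) -> (forall I, F I -> is_ideal I) ->
  exists M, F M /\ forall I, F I -> M `<=` I -> I `<=` M.
Proof.
move=> noethA F0 Fid.
pose phi : {rmorphism A -> A} := idfun.
apply: (noeth_mod_max (noeth_lspan (phi := phi) noethA (l := [:: 1])) F0).
move=> I /Fid idI; split=> // y _ X [_ _ XZ] X1.
by rewrite -[y]mulr1; apply: XZ; apply: X1; rewrite inE.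
Qed.

(** * Finite subalgebras and integrality *)

Section Integrality.
Variables (A K : comPzRingType) (phi : {rmorphism A -> K}).
Implicit Types (X Y Z : set K) (l : seq K).

Lemma subalg_integral : subalg phi (integral phi).
Proof.
have [i1 iB iM] := integral_subring_closed phi.
have I y z : integral phi y -> integral phi z -> integral phi (y - z).
  by move=> iy iz; apply/asboolP/iB; apply/asboolP.
have J y z : integral phi y -> integral phi z -> integral phi (y * z).
  by move=> iy iz; apply/asboolP/iM; apply/asboolP.
have i0 : integral phi 0 by rewrite -(subrr 1); apply: I; apply/asboolP.
split=> //; last by apply/asboolP.
split=> // [y z iy iz|a y iy].
  by rewrite -[z]opprK -[- z]sub0r; apply: (I) => //; apply: I.
by apply: J => //; apply: integral_image.
Qed.

(** Adjoining to [lspan l0] a root [y] of a monic equation of degree [n] gives the span of the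
    [g * y ^+ i] with [g] in [l0] and [i < n], since the equation lowers every higher power. *)
Lemma finite_subalg l : (forall y, y \in l -> integral phi y) ->
  exists l', [/\ subalg phi (lspan phi l'), forall y, y \in l -> lspan phi l' y &
                 forall z, lspan phi l' z -> integral phi z].
Proof.
have iA := subalg_integral.
elim: l => [|y l IH] il.
  have spanE z : lspan phi [:: 1] z -> exists a, z = phi a.
    apply: (@lspan_sub _ _ phi _ [set z | exists a, z = phi a]); last first.
      by move=> g; rewrite inE => /eqP ->; exists 1; rewrite rmorph1.
    split.
    - by exists 0; rewrite rmorph0.
    - by move=> _ _ [a ->] [b ->]; exists (a + b); rewrite rmorphD.
    - by move=> a _ [b ->]; exists (a * b); rewrite rmorphM.
  exists [:: 1]; split=> //.
    split; [exact: submod_lspan | exact: mem_lspan (mem_head _ _) |].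
    move=> _ z /spanE [a ->] lz.
    by have [_ _] := submod_lspan phi [:: 1]; apply.
  by move=> _ /spanE [a ->]; apply: integral_image.
have [u lu|l0 [alg0 l0l int0]] := IH; first by apply: il; rewrite inE lu orbT.
have [n [c yc]] := il y (mem_head y l).
have [M0 one0 mul0] := alg0.
pose l1 := [seq g * y ^+ i | g <- l0, i <- iota 0 n].
have [Z0 ZD ZZ] := submod_lspan phi l1.
have low i u : (i < n)%N -> lspan phi l0 u -> lspan phi l1 (u * y ^+ i).
  move=> ltin l0u; rewrite mulrC.
  apply: (@lspan_sub _ _ phi l0 [set v | lspan phi l1 (y ^+ i * v)]) l0u.
    exact/submod_mul/submod_lspan.
  move=> g l0g /=; apply: mem_lspan; apply/allpairsP; exists (g, i) => /=.
  by rewrite mem_iota add0n mulrC.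
have all k u : lspan phi l0 u -> lspan phi l1 (u * y ^+ k).
  elim/ltn_ind: k u => k IHk u l0u.
  have [ltkn|lenk] := ltnP k n; first exact: low.
  rewrite -(subnK lenk) exprD mulrA.
  have -> : y ^+ n = - (\sum_(i < n) phi (c i) * y ^+ i).
    by apply/eqP; rewrite -addr_eq0; apply/eqP.
  rewrite mulrN -mulN1r -(rmorph1 phi) -rmorphN; apply: (ZZ).
  rewrite mulr_sumr; apply: (@submod_sum _ _ phi _ _ _ _ (lspan phi l1)) => [|i _].
    exact: submod_lspan.
  rewrite mulrCA; apply: (ZZ); rewrite -mulrA -exprD; apply: (IHk) => //.
  by rewrite -{2}(subnK lenk) ltn_add2l.
have gen X : submod phi X -> (forall g i, g \in l0 -> (i < n)%N -> X (g * y ^+ i)) ->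
    lspan phi l1 `<=` X.
  move=> XM Xl z; apply=> // _ /allpairsP[[g i] /= [l0g + ->]].
  by rewrite mem_iota add0n => ltin; apply: Xl.
exists l1; split.
- split; first exact: submod_lspan.
    by rewrite -[1]mulr1 -[X in _ * X](expr0 y); apply: all.
  move=> z w l1z l1w.
  apply: (gen [set v | lspan phi l1 (z * v)]) l1w; first exact/submod_mul/submod_lspan.
  move=> g i l0g ltin /=; rewrite mulrC.
  apply: (gen [set v | lspan phi l1 (g * y ^+ i * v)]) l1z; first exact/submod_mul/submod_lspan.
  move=> h j l0h ltjn /=; rewrite mulrACA -exprD; apply: all.
  by apply: mul0; apply: mem_lspan.
- move=> u; rewrite inE => /orP[/eqP ->|/l0l l0u].
    by rewrite -[y]mul1r -[y]expr1; apply: all.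
  by rewrite -[u]mulr1 -(expr0 y); apply: all.
- have [iM _ imul] := iA; apply: (gen (integral phi) iM) => g i l0g ltin.
  apply: imul; first by apply: int0; apply: mem_lspan.
  by apply: (subalgX _ iA); apply: il; rewrite mem_head.
Qed.

Lemma lspan_ord n (h : 'I_n -> K) z : lspan phi [seq h i | i <- enum 'I_n] z ->
  exists c : 'I_n -> A, z = \sum_i phi (c i) * h i.
Proof.
apply: (@lspan_sub _ _ phi _ [set z | exists c : 'I_n -> A, z = \sum_i phi (c i) * h i]).
  split.
  - by exists (fun=> 0); rewrite big1 // => i _; rewrite rmorph0 mul0r.
  - move=> _ _ [c ->] [d ->]; exists (fun i => c i + d i); rewrite -big_split /=.
    by apply: eq_bigr => i _; rewrite rmorphD mulrDl.
  - move=> a _ [c ->]; exists (fun i => a * c i); rewrite mulr_sumr.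
    by apply: eq_bigr => i _; rewrite rmorphM mulrA.
move=> _ /mapP[i _ ->]; exists (fun j => (j == i)%:R).
rewrite (bigD1 i) //= eqxx rmorph1 mul1r big1 ?addr0 // => j /negPf ->.
by rewrite rmorph0 mul0r.
Qed.

(** The span of all powers of [y] is finitely generated, hence spanned by the powers below some [n];
    expressing [y ^+ n] by these gives the equation. *)
Lemma integral_noeth X y :
  submod phi X -> noeth_mod phi X -> (forall j, X (y ^+ j)) -> integral phi y.
Proof.
move=> XM nX Xy.
pose P n := lspan phi [seq y ^+ (i : 'I_n) | i <- enum 'I_n].
have Pmem n i : (i < n)%N -> P n (y ^+ i).
  by move=> ltin; apply: mem_lspan; apply/mapP; exists (Ordinal ltin); rewrite ?mem_enum.
have PS n k : (n <= k)%N -> P n `<=` P k.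
  move=> lenk z; apply; first exact: submod_lspan.
  by move=> _ /mapP[i _ ->]; apply: Pmem; apply: leq_trans lenk.
have [||l [lY Yl]] := nX [set z | exists n, P n z].
- split.
  + by exists 0%N; case: (submod_lspan phi [seq y ^+ (i : 'I_0) | i <- enum 'I_0]).
  + move=> z w [n nz] [k kw]; exists (maxn n k).
    have [_ ZD _] := submod_lspan phi [seq y ^+ (i : 'I_(maxn n k)) | i <- enum 'I_(maxn n k)].
    by apply: ZD; [apply: (PS n) => //; apply: leq_maxl | apply: (PS k) => //; apply: leq_maxr].
  + move=> a z [n nz]; exists n.
    by have [_ _ ZZ] := submod_lspan phi [seq y ^+ (i : 'I_n) | i <- enum 'I_n]; apply: (ZZ).
- by move=> z [n]; apply: lspan_sub z => // _ /mapP[i _ ->].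
have [n nl] : exists n, forall g, g \in l -> P n g.
  elim: l lY {Yl} => [|g l IH] lY; first by exists 0%N.
  have [u lu|n nl] := IH; first by apply: lY; rewrite inE lu orbT.
  have [k kg] := lY g (mem_head g l); exists (maxn n k) => u.
  rewrite inE => /orP[/eqP ->|/nl nu]; [apply: (PS k) | apply: (PS n)] => //.
    exact: leq_maxr.
  exact: leq_maxl.
have Pn : P n (y ^+ n).
  by apply: Yl; [exists n.+1; apply: Pmem | apply: submod_lspan | apply: nl].
have [c yc] := lspan_ord Pn.
exists n, (fun i => - c i); rewrite yc -big_split big1 //= => i _.
by rewrite rmorphN mulNr addrN.
Qed.

End Integrality.

(** * Matijevic's finiteness argument *)

Section Saturated.
Variables (A K : comPzRingType) (phi : {rmorphism A -> K}) (m : set A).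
Hypotheses (noethA : noetherian A) (mP : is_prime m).
Implicit Types (X Y Z : set K) (l : seq K).

Let submod := submod phi.
Let lspan := lspan phi.
Let noeth_mod := noeth_mod phi.

(** Saturated submodules stand for submodules of the localization at [m], which is never formed. *)
Definition saturated X := forall s y, ~ m s -> X (phi s * y) -> X y.

Lemma prime_compl1 : ~ m 1.
Proof. by case: mP. Qed.

Lemma prime_complM s t : ~ m s -> ~ m t -> ~ m (s * t).
Proof. by move=> ms mt; have [_ _ +] := mP; move=> /(_ s t) H /H []. Qed.

(** For submodules, this represents [X0 + X] localized at [m]; with [X0] zero it is the saturation
    of [X]. *)
Definition sat_sum X0 X : set K :=
  [set y | exists s u v, [/\ ~ m s, X0 u, X v & phi s * y = u + v]].

Lemma submod_sat_sum X0 X : submod X0 -> submod X -> submod (sat_sum X0 X).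
Proof.
move=> [U0 UD UZ] [V0 VD VZ]; split.
- exists 1, 0, 0; split=> //; first exact: prime_compl1.
  by rewrite mulr0 addr0.
- move=> y z [s [u [v [ms Uu Vv ye]]]] [t [u' [v' [mt Uu' Vv' ze]]]].
  exists (s * t), (phi t * u + phi s * u'), (phi t * v + phi s * v'); split.
  + exact: prime_complM.
  + by apply: UD; apply: (UZ).
  + by apply: VD; apply: (VZ).
  + rewrite rmorphM mulrDr -[phi s * phi t * z]mulrA ze mulrAC ye; ring.
- move=> a y [s [u [v [ms Uu Vv ye]]]]; exists s, (phi a * u), (phi a * v).
  by split=> //; [apply: UZ | apply: VZ | rewrite mulrCA ye mulrDr].
Qed.

Lemma saturated_sat_sum X0 X : saturated (sat_sum X0 X).
Proof.
move=> s y ms [t [u [v [mt Uu Vv ye]]]]; exists (t * s), u, v.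
by split=> //; [apply: prime_complM | rewrite rmorphM -mulrA].
Qed.

Lemma sat_sum_subl X0 X : submod X -> X0 `<=` sat_sum X0 X.
Proof.
move=> [X00 _ _] u Uu; exists 1, u, 0; rewrite rmorph1 mul1r addr0.
by split=> //; apply: prime_compl1.
Qed.

Lemma sat_sum_subr X0 X : submod X0 -> X `<=` sat_sum X0 X.
Proof.
move=> [X00 _ _] u Uu; exists 1, 0, u; rewrite rmorph1 mul1r add0r.
by split=> //; apply: prime_compl1.
Qed.

Lemma sat_sum_sub X0 X Y : submod Y -> saturated Y -> X0 `<=` Y -> X `<=` Y ->
  sat_sum X0 X `<=` Y.
Proof.
move=> [_ YD _] Ysat U V y [s [u [v [ms Uu Vv ye]]]].
by apply: (Ysat s) => //; rewrite ye; apply: YD; [apply: U | apply: V].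
Qed.

(** Since [E] is [X0 + X] up to denominators, two nested saturated submodules between [X0] and [E]
    with the same trace on [X] coincide; so it suffices to maximize the trace. *)
Lemma sat_noeth_max X0 X E (F : set (set K)) :
  noeth_mod X -> X `<=` E -> submod X -> E `<=` sat_sum X0 X ->
  (exists Y, F Y) ->
  (forall Y, F Y -> [/\ submod Y, saturated Y, X0 `<=` Y & Y `<=` E]) ->
  exists M, F M /\ forall Y, F Y -> M `<=` Y -> Y `<=` M.
Proof.
move=> nX XE XM Egen [Y0 FY0] FP.
have [||_ [[M FM <-] maxM]] :=
  @noeth_mod_max _ _ phi X [set Z | exists2 Y, F Y & Y `&` X = Z] nX.
- by exists (Y0 `&` X), Y0.
- move=> _ [Y FY <-]; have [YM _ _ _] := FP Y FY.
  by split; [apply: submodI | move=> y []].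
exists M; split=> // Y FY MY y Yy.
have [YM Ysat XY YE] := FP Y FY; have [MM Msat XM' ME] := FP M FM.
have [s [u [v [ms Uu Vv ye]]]] := Egen y (YE y Yy).
apply: (Msat s) => //; rewrite ye.
have [_ MD _] := MM; apply: MD; first exact: XM'.
suff Yv : (Y `&` X) v.
  have [||//] := maxM (Y `&` X) _ _ v Yv; first by exists Y.
  by move=> z [Mz Xz]; split=> //; apply: MY.
split=> //; rewrite (_ : v = phi s * y - u); last by rewrite ye addrC addKr.
by apply: (submodB YM); [have [_ _] := YM; apply | apply: XY].
Qed.

Lemma sat_noeth_gen X0 X E Y :
  noeth_mod X -> submod X -> E `<=` sat_sum X0 X ->
  submod Y -> X0 `<=` Y -> Y `<=` E ->
  exists l, (forall g, g \in l -> Y g) /\ Y `<=` sat_sum X0 (lspan l).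
Proof.
move=> nX XM Egen YM XY YE.
have [||l [lY Yl]] := nX (Y `&` X).
- exact: submodI.
- by move=> y [].
exists l; split=> [g /lY[] //|y Yy].
have [s [u [v [ms Uu Vv ye]]]] := Egen y (YE y Yy).
exists s, u, v; split=> //; apply: Yl; split=> //.
rewrite (_ : v = phi s * y - u); last by rewrite ye addrC addKr.
by apply: (submodB YM); [have [_ _] := YM; apply | apply: XY].
Qed.

(* The quotient of sat_sum M (A g) by M becomes simple after localization at m. *)
Lemma stationary_sat_sum (J : nat -> set K) M g :
  (forall n, submod (J n)) -> (forall n, saturated (J n)) ->
  (forall n k, (n <= k)%N -> J k `<=` J n) ->
  submod M -> saturated M -> (forall c, m c -> M (phi c * g)) ->
  (exists N, forall n, (N <= n)%N -> M `&` J N `<=` J n) ->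
  exists N, forall n, (N <= n)%N ->
    sat_sum M [set phi a * g | a in setT] `&` J N `<=` J n.
Proof.
move=> JM Jsat Jdec MM Msat mg [N statN].
set M' := sat_sum _ _.
(* Either [M'] meets some [J n1] inside [M], where stationarity is known, or every [J n] contains an
   element of [M'] outside [M], which generates [M'] modulo [M] up to denominators. *)
have [[n1 sub1]|nosub] := pselect (exists n1, M' `&` J n1 `<=` M).
  exists (maxn N n1) => n; rewrite geq_max => /andP[leNn len1n] y [M'y Jy].
  apply: statN => //; split; last exact: Jdec (leq_maxl N n1) _ Jy.
  by apply: sub1; split=> //; apply: Jdec (leq_maxr N n1) _ Jy.
exists N => n leNn y [[t [w' [_ [mt Mw' [a' _ <-] ye]]]] Jy].
have [z [[s [w [_ [ms Mw [a _ <-] ze]]]] Jz Mz]] : exists z, [/\ M' z, J n z & ~ M z].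
  apply: contrapT => noz; apply: nosub; exists n => z [M'z Jz].
  by apply: contrapT => Mz; apply: noz; exists z.
have [M0 MD MZ] := MM.
have ma : ~ m a.
  by move=> ma; apply: Mz; apply: (Msat s) => //; rewrite ze; apply: MD => //; apply: mg.
have JZ k b u : J k u -> J k (phi b * u) by case: (JM k) => _ _; apply.
apply: (Jsat n (a * t)); first exact: prime_complM.
(* The multiples of [g] in [y] and [z] cancel, which leaves an element of [M] and [J N], hence of
   [J n]. *)
have zE : phi (a * t) * y = (phi a * w' - phi a' * w) + phi (a' * s) * z.
  by rewrite !rmorphM -!mulrA ye ze; ring.
rewrite zE; have [_ JD _] := JM n; apply: JD; last exact: JZ.
apply: statN => //; split; first by apply: (submodB MM); apply: MZ.
rewrite (_ : _ - _ = phi (a * t) * y - phi (a' * s) * z); last by rewrite zE addrK.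
by apply: (submodB (JM N)); apply: JZ => //; apply: Jdec Jz.
Qed.

(* E is finitely generated modulo x, up to denominators outside m.  With J n the
   elements of R lying in x^n E + x R, the modules J n / x R are, for n > 0, m-torsion
   in a finite module, so the decreasing sequence J is stationary. *)
Lemma sat_gen_mod_regular l (R E : set K) x xi :
  subalg phi R -> saturated R -> lspan l `<=` R -> R `<=` sat_sum [set 0] (lspan l) ->
  submod E -> R `<=` E ->
  (forall a y, m a -> E y -> exists k, R (phi a ^+ k * y)) ->
  m x -> phi x * xi = 1 ->
  exists N, E `<=` sat_sum [set phi x * y | y in E] [set xi ^+ N * r | r in R].
Proof.
move=> Ralg Rsat lR Rl EM RE ER mx xxi.
have [RM R1 RR] := Ralg; have [R0 RD RZ] := RM; have [E0 ED EZ] := EM.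
have xiK y : phi x * (xi * y) = y by rewrite mulrA xxi mul1r.
have xK y : xi * (phi x * y) = y by rewrite mulrA [xi * _]mulrC xxi mul1r.
(* [L] is [x R], as [xi] inverts [phi x]. *)
pose L := [set y | R (xi * y)].
have LM : submod L by apply: submod_mul.
have Lsat : saturated L.
  by move=> s y ms; rewrite /L /= mulrCA; apply: Rsat.
have LR : L `<=` R by move=> y Ly; rewrite -(xiK y); apply: RZ.
have xL r : R r -> L (phi x * r) by rewrite /L /= xK.
have xEM n : submod [set phi x ^+ n * y | y in E].
  split.
  - by exists 0; rewrite ?mulr0.
  - by move=> _ _ [y Ey <-] [z Ez <-]; exists (y + z); [apply: ED | rewrite mulrDr].
  - by move=> a _ [y Ey <-]; exists (phi a * y); [apply: EZ | rewrite mulrCA].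
pose J n := R `&` sat_sum [set phi x ^+ n * y | y in E] L.
have JM n : submod (J n) by apply: submodI => //; apply: submod_sat_sum.
have Jsat n : saturated (J n).
  by move=> s y ms [Ry Sy]; split; [apply: Rsat Ry | apply: saturated_sat_sum Sy].
have Jdec n k : (n <= k)%N -> J k `<=` J n.
  move=> lenk y [Ry [s [_ [v [ms [w Ew <-] Lv ye]]]]]; split=> //.
  exists s, (phi x ^+ k * w), v; split=> //.
  exists (phi x ^+ (k - n) * w); last by rewrite mulrA -exprD subnKC.
  by rewrite -rmorphXn; apply: EZ.
pose stat Y := exists N, forall n, (N <= n)%N -> Y `&` J N `<=` J n.
(* [M] is maximal among the saturated submodules between [L] and [R] on which [J] becomes
   stationary; the aim is that it contains [J 1]. *)
have [||M [[[MM Msat LM' MR] statM] maxM]] := @sat_noeth_max [set 0] (lspan l) R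
    [set Y | [/\ submod Y, saturated Y, L `<=` Y & Y `<=` R] /\ stat Y]
    (@noeth_lspan _ _ phi noethA l) lR (submod_lspan _ _) Rl.
- exists L; split; first by split.
  exists 0%N => n _ y [Ly _]; split; first exact: LR.
  exact: sat_sum_subr.
- move=> Y [[YM Ysat LY YR] _]; split=> // _ ->.
  by case: YM.
have J1M : J 1%N `<=` M.
  move=> h Jh; apply: contrapT => Mh.
  have [Rh [s [_ [v [ms [w Ew <-] Lv he]]]]] := Jh.
  (* Among the multiples of [h] outside [M], one, [g], has maximal annihilator modulo [M]. Each
     element of [m] has a power killing [g] modulo [M], so by maximality it kills [g] itself; then
     [M] can be enlarged by [g]. *)
  have [||_ [[a Ma <-] maxa]] := @noetherian_max A
    [set I | exists2 a, ~ M (phi a * h) & [set c | M (phi c * (phi a * h))] = I] noethA.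
  + exists [set c | M (phi c * (phi 1 * h))], 1 => //.
    by rewrite rmorph1 mul1r.
  + move=> _ [a _ <-]; have [M0 MD MZ] := MM; split=> /=.
    * by rewrite rmorph0 mul0r.
    * by move=> c d Mc Md; rewrite rmorphD mulrDl; apply: MD.
    * by move=> c d Md; rewrite rmorphM -mulrA; apply: MZ.
  pose g := phi a * h.
  have mg c : m c -> M (phi c * g).
    move=> mc; apply: contrapT => Mcg.
    have desc d : M (phi d * (phi c * g)) -> M (phi d * g).
      move=> Md; apply: (maxa [set d | M (phi d * (phi (c * a) * h))]).
      - by exists (c * a); rewrite // rmorphM -mulrA.
      - move=> e /= Me; rewrite rmorphM -!mulrA mulrCA.
        by have [_ _] := MM; apply.
      - by rewrite /= rmorphM -!mulrA.
    have [k Rk] := ER c w mc Ew.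
    have Mk : M (phi (c ^+ k) * g).
      apply: (Msat s) => //; apply: LM'.
      rewrite (_ : _ * _ = phi a * (phi x * (phi c ^+ k * w) + phi (c ^+ k) * v)).
        have [_ LD LZ] := LM; apply: (LZ); apply: LD; first exact: xL.
        exact: LZ.
      by rewrite /g -rmorphXn; have := he; rewrite expr1 => he'; ring: he'.
    elim: k {Rk} Mk => [|k IH Mk].
      by rewrite expr0 rmorph1 mul1r.
    by apply: IH; apply: desc; rewrite mulrA -rmorphM -exprSr.
  have Ag : submod [set phi b * g | b in setT].
    split.
    - by exists 0; rewrite // rmorph0 mul0r.
    - by move=> _ _ [b _ <-] [c _ <-]; exists (b + c); rewrite // rmorphD mulrDl.
    - by move=> b _ [c _ <-]; exists (b * c); rewrite // rmorphM mulrA.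
  apply: (Ma); apply: (maxM (sat_sum M [set phi b * g | b in setT])).
  + split; last exact: stationary_sat_sum.
    split; [exact: submod_sat_sum | exact: saturated_sat_sum | |].
      by move=> y /LM'; apply: sat_sum_subl.
    apply: sat_sum_sub => // _ [b _ <-].
    by apply: (RZ); apply: (RZ).
  + exact: sat_sum_subl.
  + by apply: sat_sum_subr => //; exists 1; rewrite // rmorph1 mul1r.
have [N0 statN0] := statM.
(* The bound [1] puts [J N] inside [J 1], hence inside [M]. *)
pose N := maxn N0 1; exists N.
have statN n : (N <= n)%N -> J N `<=` J n.
  move=> leNn y Jy; apply: statN0; first exact: leq_trans (leq_maxl _ _) leNn.
  split; last exact: Jdec (leq_maxl N0 1) _ Jy.
  by apply: J1M; apply: Jdec (leq_maxr N0 1) _ Jy.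
have powK k : xi ^+ k * phi x ^+ k = 1 by rewrite -exprMn [xi * _]mulrC xxi expr1n.
have RM' : submod [set xi ^+ N * r | r in R].
  split.
  - by exists 0; rewrite ?mulr0.
  - by move=> _ _ [y Ey <-] [z Ez <-]; exists (y + z); [apply: RD | rewrite mulrDr].
  - by move=> a _ [y Ey <-]; exists (phi a * y); [apply: RZ | rewrite mulrCA].
set SS := sat_sum _ _.
have SSM : submod SS.
  by apply: submod_sat_sum => //; have := xEM 1%N; rewrite expr1.
(* Induction on the number [k] of factors [phi x], beyond [N], that carry [y] into [R]. *)
suff main k y : E y -> R (phi x ^+ (N + k) * y) -> SS y.
  move=> y Ey; have [k Rk] := ER x y mx Ey; apply: (main k) => //.
  by rewrite exprD -mulrA -rmorphXn; apply: RZ.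
elim: k y => [|k IH] y Ey Ry.
  apply: sat_sum_subr; first by have := xEM 1%N; rewrite expr1.
  by exists (phi x ^+ N * y); rewrite ?mulrA ?powK ?mul1r // -[N]addn0.
have JNy : J (N + k.+1)%N (phi x ^+ (N + k.+1) * y).
  by split=> //; apply: sat_sum_subl => //; exists y.
(* Stationarity raises the index to [N + k.+2]; dividing the relation by [phi x] shows that
   [phi s * y - phi x * w] needs only the exponent [N + k]. *)
have [_ [s [_ [v [ms [w Ew <-] Lv ye]]]]] := statN (N + k.+2)%N (leq_addr _ _) _
  (Jdec _ _ (leq_addr k.+1 N) _ JNy).
have ye' : phi x ^+ (N + k) * (phi s * y - phi x * w) = xi * v.
  rewrite -[LHS]xK; congr (xi * _); apply: (addrI (phi x ^+ (N + k.+2) * w)).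
  by rewrite -ye !addnS !exprS; ring.
have Ew' : E (phi s * y - phi x * w) by apply: (submodB EM); apply: EZ.
have SSw := IH _ Ew'.
apply: (saturated_sat_sum (s := s)) => //.
rewrite -[phi s * y](subrK (phi x * w)).
have [_ SD _] := SSM; apply: SD.
  by apply: SSw; rewrite ye'.
by apply: sat_sum_subl => //; exists w.
Qed.

End Saturated.

(** * Primes of the integral closure *)

Section IntegrallyClosed.
Variables (A K : comPzRingType) (phi : {rmorphism A -> K}).
Hypothesis noethA : noetherian A.
Implicit Types (X Y Z : set K) (l : seq K).

Let D := integral phi.

Lemma noeth_lspan_scale l x xi : x * xi = 1 ->
  noeth_mod phi [set z | lspan phi l (x * z)].
Proof.
move=> xxi.
apply: (@noeth_modS _ _ phi _ (lspan phi [seq xi * g | g <- l])).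
  move=> z /= lz; rewrite -[z]mul1r -xxi [x * _]mulrC -mulrA.
  apply: (@lspan_sub _ _ phi l [set w | lspan phi [seq xi * g | g <- l] (xi * w)]) lz.
    exact/submod_mul/submod_lspan.
  by move=> g lg; apply: mem_lspan; apply: map_f.
exact: noeth_lspan.
Qed.

(** For a multiplicative set [S] in [D], the preimage in [K] of the localization of [D] at [S];
    elements of [S] may be zero divisors. *)
Definition frac_set (S : set K) : set K := [set y | exists2 t, S t & D (t * y)].

Definition mult_set (S : set K) := [/\ S `<=` D, S 1 & forall s t, S s -> S t -> S (s * t)].

Section FracSet.
Variable S : set K.
Hypothesis Smult : mult_set S.

Lemma frac_set_common l : (forall y, y \in l -> frac_set S y) ->
  exists2 t, S t & forall y, y \in l -> D (t * y).
Proof.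
have [SD S1 SM] := Smult; have [_ _ DM] := subalg_integral phi.
elim: l => [|y l IH] lV; first by exists 1.
have [u lu|t St tl] := IH; first by apply: lV; rewrite inE lu orbT.
have [u Su uy] := lV y (mem_head y l).
exists (t * u) => [|z]; first exact: SM.
rewrite inE => /orP[/eqP ->|/tl tz]; first by rewrite -mulrA; apply: DM => //; apply: SD.
by rewrite mulrAC mulrC; apply: DM => //; apply: SD.
Qed.

Lemma frac_set_sub : D `<=` frac_set S.
Proof. by have [_ S1 _] := Smult; move=> y Dy; exists 1; rewrite // mul1r. Qed.

Lemma subalg_frac_set : subalg phi (frac_set S).
Proof.
have [SD S1 SM] := Smult; have [[D0 DD DZ] D1 DM] := subalg_integral phi.
split; last 2 first.
- exact: frac_set_sub.
- move=> y z [t St ty] [u Su uz]; exists (t * u); first exact: SM.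
  by rewrite mulrACA; apply: DM.
split.
- exact: frac_set_sub.
- move=> y z [t St ty] [u Su uz]; exists (t * u); first exact: SM.
  rewrite mulrDr; apply: DD; last by rewrite -mulrA; apply: DM => //; apply: SD.
  by rewrite mulrAC mulrC; apply: DM => //; apply: SD.
- by move=> a y [t St ty]; exists t => //; rewrite mulrCA; apply: DZ.
Qed.

Lemma frac_set_div t y : S t -> frac_set S (t * y) -> frac_set S y.
Proof.
have [_ _ SM] := Smult; move=> St [u Su Dy].
by exists (u * t); [apply: SM | rewrite -mulrA].
Qed.

End FracSet.

(* A multiple of y by some element of S is an endomorphism of a finite module over
   a finite subalgebra of D, which contains the unit phi x. *)
Lemma frac_set_integral (S : set K) (m : set A) (n : set K) l x xi y :
  mult_set S -> is_prime m -> (forall s, ~ m s -> S (phi s)) ->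
  phi x * xi = 1 -> n (phi x) -> (forall g, g \in l -> n g) ->
  n `<=` sat_sum phi m [set phi x * e | e in frac_set S] (lspan phi l) ->
  (forall z, n z -> n (z * y)) -> frac_set S y.
Proof.
move=> Smult mP mS xxi nx nl ngen ny.
have [SD S1 SM] := Smult; have [[D0 DD DZ] D1 DM] := subalg_integral phi.
pose hs := phi x :: l.
(* When [lspan l2] is an algebra, [N l2] is the module over it generated by [hs]. *)
pose N l2 := lspan phi [seq u * h | u <- l2, h <- hs].
have NM l2 u z : subalg phi (lspan phi l2) -> lspan phi l2 u -> N l2 z -> N l2 (u * z).
  move=> [_ _ mul2] l2u.
  apply: (@lspan_sub _ _ phi _ [set z | N l2 (u * z)]).
    exact/submod_mul/submod_lspan.
  move=> _ /allpairsP[[v h] /= [l2v hsh ->]]; rewrite mulrA.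
  have := mul2 _ _ l2u (mem_lspan l2v).
  rewrite [_ * h]mulrC.
  apply: (@lspan_sub _ _ phi _ [set w | N l2 (h * w)]).
    exact/submod_mul/submod_lspan.
  move=> w l2w; apply: mem_lspan; apply/allpairsP; exists (w, h) => /=.
  by rewrite mulrC.
have Nh l2 h : subalg phi (lspan phi l2) -> h \in hs -> N l2 h.
  move=> [_ one2 _] hsh; rewrite -[h]mulr1.
  apply: (@lspan_sub _ _ phi _ [set w | N l2 (h * w)]) one2.
    exact/submod_mul/submod_lspan.
  move=> w l2w; apply: mem_lspan; apply/allpairsP; exists (w, h) => /=.
  by rewrite mulrC.
(* If [phi s * h = phi x * e + w] with [t * e] in [D], then [t * phi s * h] combines [phi x] and [w]
   with coefficients [t * e] and [t]; [l3] collects these and the multiplier. *)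
have one h : n h -> exists tau l3, [/\ S tau, forall u, u \in l3 -> D u &
    forall l2, subalg phi (lspan phi l2) ->
      (forall u, u \in l3 -> lspan phi l2 u) -> lspan phi l2 tau /\ N l2 (tau * h)].
  move=> /ngen [s [_ [w [ms [e [t St Dte] <-] lw he]]]].
  exists (t * phi s), [:: t * phi s; t; t * e]; split.
  - by apply: SM => //; apply: mS.
  - move=> u; rewrite !inE => /or3P[] /eqP -> //; last exact: SD.
    by apply: DM; [apply: SD | apply: integral_image].
  - move=> l2 alg2 l32; split; first by apply: l32; rewrite inE eqxx.
    rewrite -mulrA he mulrDr [phi x * e]mulrC mulrA.
    have [_ ND _] := submod_lspan phi [seq u * h | u <- l2, h <- hs].
    apply: ND; apply: NM => //; try by apply: l32; rewrite !inE eqxx ?orbT.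
      by apply: Nh => //; apply: mem_head.
    apply: (@lspan_sub _ _ phi l) lw; first exact: submod_lspan.
    by move=> g lg; apply: Nh => //; rewrite inE lg orbT.
have many l' : (forall h, h \in l' -> n h) ->
    exists tau l3, [/\ S tau, forall u, u \in l3 -> D u &
    forall l2, subalg phi (lspan phi l2) ->
      (forall u, u \in l3 -> lspan phi l2 u) ->
      lspan phi l2 tau /\ forall h, h \in l' -> N l2 (tau * h)].
  elim: l' => [|h l' IH] nl'.
    by exists 1, [::]; split=> // l2 [_ one2 _] _; split.
  have [u l'u|t1 [l3 [St1 l3D H1]]] := IH; first by apply: nl'; rewrite inE l'u orbT.
  have [t2 [l4 [St2 l4D H2]]] := one h (nl' h (mem_head h l')).
  exists (t1 * t2), (l3 ++ l4); split; first exact: SM.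
    by move=> u; rewrite mem_cat => /orP[/l3D|/l4D].
  move=> l2 alg2 l34.
  have [|l2t1 N1] := H1 l2 alg2; first by move=> u l3u; apply: l34; rewrite mem_cat l3u.
  have [|l2t2 N2] := H2 l2 alg2; first by move=> u l4u; apply: l34; rewrite mem_cat l4u orbT.
  split; first by have [_ _] := alg2; apply.
  move=> u; rewrite inE => /orP[/eqP ->|/N1 Nu].
    by rewrite -mulrA; apply: NM.
  by rewrite mulrAC mulrC; apply: NM.
have [|tau [l3 [Stau l3D H]]] := many [seq h * y | h <- hs].
  move=> _ /mapP[h + ->]; rewrite inE => /orP[/eqP ->|/nl nh]; exact: ny.
have [l2 [alg2 l32 l2D]] := finite_subalg l3D.
have [l2tau Ntau] := H l2 alg2 l32.
exists tau => //.
have yN z : N l2 z -> N l2 (tau * y * z).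
  apply: (@lspan_sub _ _ phi _ [set z | N l2 (tau * y * z)]).
    exact/submod_mul/submod_lspan.
  move=> _ /allpairsP[[u h] /= [l2u hsh ->]].
  rewrite (_ : _ * _ = u * (tau * (h * y))); last by ring.
  by apply: NM; [| exact: mem_lspan | apply: Ntau; apply/mapP; exists h].
apply: (@integral_noeth _ _ phi [set z | N l2 (phi x * z)]).
- exact/submod_mul/submod_lspan.
- exact: noeth_lspan_scale xxi.
- elim=> [|j IH] /=; first by rewrite expr0 mulr1; apply: Nh => //; apply: mem_head.
  by rewrite exprS mulrCA; apply: yN.
Qed.

(** In the conclusion, the [y] in [E] with [y * (e * b)] in [V] form a prime ideal of [E];
    multiplication by [e * b] carries its element [c] to an element of [E] outside it. *)
Lemma noeth_transform (S : set K) (m : set A) x xi b :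
  mult_set S -> is_prime m -> (forall s, ~ m s -> S (phi s)) ->
  m x -> phi x * xi = 1 -> (forall a, m a -> D (phi a * b)) ->
  let V := frac_set S in
  ~ V b ->
  exists E e c, [/\ subalg phi E, E `<=` V, E e /\ ~ V (e * b),
    forall y z, E y -> E z -> ~ V (y * (e * b)) -> ~ V (z * (e * b)) ->
      ~ V (y * z * (e * b)) &
    [/\ E c, V (c * (e * b)), E (c * (e * b)) & ~ V (c * (e * b) * (e * b))]].
Proof.
move=> Smult mP mS mx xxi mb V Vb.
have [SD S1 SM] := Smult; have [[D0 DD DZ] D1 DM] := subalg_integral phi.
have [VM V1 VV] : subalg phi V := subalg_frac_set Smult.
have Vsat : saturated phi m V.
  by move=> s y /mS Ss; apply: frac_set_div.
have [m0 mD mM] : is_ideal m by case: mP.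
(* As a submodule of the span of [b], [m b] is generated by finitely many elements, all integral,
   hence lies in a finite algebra. *)
have [||l [lmb mbl]] := @noeth_lspan _ _ phi noethA [:: b] [set phi a * b | a in m].
- split.
  + by exists 0; rewrite // rmorph0 mul0r.
  + by move=> _ _ [a ma <-] [c mc <-]; exists (a + c); rewrite ?rmorphD ?mulrDl //; apply: mD.
  + by move=> a _ [c mc <-]; exists (a * c); rewrite ?rmorphM ?mulrA //; apply: mM.
- move=> _ [a _ <-]; have [_ _ Z] := submod_lspan phi [:: b].
  by apply: Z; apply: mem_lspan; apply: mem_head.
have [|l1 [alg1 ll1 l1D]] := @finite_subalg _ _ phi l.
  by move=> _ /lmb [a ma <-]; apply: mb.
have [M1 one1 mul1] := alg1.
pose R := sat_sum phi m [set 0] (lspan phi l1).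
have zM : submod phi [set 0].
  by split=> // [_ _ -> ->|a _ ->] /=; rewrite ?addr0 ?mulr0.
have l1R : lspan phi l1 `<=` R by apply: sat_sum_subr.
have Ralg : subalg phi R.
  split; [exact: submod_sat_sum | exact: l1R |].
  move=> y z [s [_ [u [ms -> l1u yu]]]] [t [_ [v [mt -> l1v zv]]]].
  exists (s * t), 0, (u * v); split=> //; first exact: prime_complM.
    exact: mul1.
  by rewrite rmorphM mulrACA yu zv !add0r.
have [RM R1 RR] := Ralg; have [R0 RD RZ] := RM.
have Rsat : saturated phi m R by apply: saturated_sat_sum.
have RV : R `<=` V.
  apply: sat_sum_sub => // [_ ->|y /l1D]; first by case: VM.
  exact: frac_set_sub.
(* [T] is the ideal transform of [R] at [m]; it contains [b] because [m b] lies in [R]. *)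
pose T := [set y | forall a, m a -> exists k, R (phi a ^+ k * y)].
have RpowZ a k y : R y -> R (phi a ^+ k * y) by rewrite -rmorphXn; apply: RZ.
have RT : R `<=` T by move=> y Ry a ma; exists 0%N; rewrite mul1r.
have Talg : subalg phi T.
  split; [split| |].
  - exact: RT.
  - move=> y z Ty Tz a ma; have [k Rk] := Ty a ma; have [j Rj] := Tz a ma.
    exists (k + j)%N; rewrite mulrDr; apply: RD.
      by rewrite exprD mulrAC mulrC; apply: RpowZ.
    by rewrite exprD -mulrA; apply: RpowZ.
  - move=> c y Ty a ma; have [k Rk] := Ty a ma; exists k.
    by rewrite mulrCA; apply: RZ.
  - exact: RT.
  - move=> y z Ty Tz a ma; have [k Rk] := Ty a ma; have [j Rj] := Tz a ma.
    by exists (k + j)%N; rewrite exprD mulrACA; apply: RR.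
have [TM T1 TT] := Talg.
have Tb : T b.
  move=> a ma; exists 1%N; rewrite expr1; apply: l1R.
  have : lspan phi l (phi a * b) by apply: mbl; exists a.
  exact: lspan_sub.
pose E := V `&` T.
have EM : submod phi E by apply: submodI.
have [E0 ED EZ] := EM.
have EE y z : E y -> E z -> E (y * z).
  by move=> [Vy Ty] [Vz Tz]; split; [apply: VV | apply: TT].
have [N Egen] : exists N, E `<=` sat_sum phi m [set phi x * y | y in E] [set xi ^+ N * r | r in R].
  apply: (@sat_gen_mod_regular _ _ phi m noethA mP l1) => //.
  - by move=> y Ry; split; [apply: RV | apply: RT].
  - by move=> a y ma [_ +]; apply.
(* [G] is Noetherian, lying in [xi ^+ N] times a finite module, and still generates [E] modulo
   [phi x] up to denominators. *)
pose G := E `&` [set y | lspan phi l1 (phi x ^+ N * y)].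
have GM : submod phi G by apply: submodI => //; apply/submod_mul/submod_lspan.
have nG : noeth_mod phi G.
  apply: (@noeth_modS _ _ phi _ [set y | lspan phi l1 (phi x ^+ N * y)]) => [y []//|].
  by apply: (@noeth_lspan_scale _ _ (xi ^+ N)); rewrite -exprMn xxi expr1n.
have EG : E `<=` sat_sum phi m [set phi x * y | y in E] G.
  move=> y /[dup] Ey /Egen [s [_ [_ [ms [e Ee <-] [r Rr <-] ye]]]].
  have [t [_ [r1 [mt -> l1r re]]]] := Rr.
  have ye' : phi (t * s) * y = phi x * (phi t * e) + xi ^+ N * r1.
    have -> : r1 = phi t * r by rewrite re add0r.
    by rewrite rmorphM -mulrA ye; ring.
  exists (t * s), (phi x * (phi t * e)), (xi ^+ N * r1); split=> //.
  - exact: prime_complM.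
  - by exists (phi t * e) => //; apply: EZ.
  - split.
      rewrite (_ : _ * _ = phi (t * s) * y - phi x * (phi t * e)).
        by apply: (submodB EM); do ?apply: (EZ).
      by rewrite ye' addrC addKr.
    by rewrite /= mulrA -exprMn xxi expr1n mul1r.
pose n e := E `&` [set y | V (y * (e * b))].
have nM e : submod phi (n e).
  apply: submodI => //; have := submod_mul (e * b) VM.
  by rewrite (_ : [set y | _] = [set y | V (y * (e * b))]) //; apply: eq_set => y; rewrite mulrC.
(* Because [phi x * b] lies in [D], each [n e] contains [phi x] times [E]; finiteness modulo [phi x]
   then yields a maximal one. *)
have xn e : E e -> [set phi x * y | y in E] `<=` n e.
  move=> [Ve _] _ [y Ey <-]; split; first exact: EZ.
  rewrite /= (_ : _ * _ = (phi x * b) * (y * e)); last by ring.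
  apply: (VV); last by apply: VV => //; case: Ey.
  by apply: (frac_set_sub Smult); apply: mb.
have [||_ [[e [Ee Veb] <-] maxe]] := @sat_noeth_max _ _ phi m _ _ _
    [set I | exists2 e, E e /\ ~ V (e * b) & n e = I] nG (fun y => @proj1 _ _) GM EG.
- exists (n 1), 1 => //; rewrite mul1r; split=> //; split=> //.
- move=> _ [e [Ee _] <-]; split=> //; last by move=> y [].
    move=> s y ms [Ey Vy]; split.
      case: Ey => Vsy Tsy; split; first exact: Vsat Vsy.
      move=> a ma; have [k Rk] := Tsy a ma; exists k.
      by apply: (Rsat s) => //; rewrite mulrCA.
    by apply: (Vsat s) => //; rewrite mulrA.
  exact: xn.
have nprime y z : E y -> E z -> ~ V (y * (e * b)) -> ~ V (z * (e * b)) ->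
    ~ V (y * z * (e * b)).
  move=> Ey Ez Vy Vz Vyz; apply: Vz.
  (* [n (y * e)] contains [n e] and is proper since [y * (e * b)] is outside [V], so maximality
     applies. *)
  suff sub : n (y * e) `<=` n e.
    suff [] : n e z by [].
    apply: sub; split=> //=.
    by rewrite (_ : _ * _ = y * z * (e * b)) //; ring.
  apply: maxe; first by exists (y * e) => //; split; [exact: EE | rewrite -mulrA].
  move=> w [Ew Vw]; split=> //=; case: Ey => Vyy _.
  by rewrite (_ : _ * _ = y * (w * (e * b))); [apply: VV | ring].
have nE y : n e y -> E (y * (e * b)).
  move=> [[_ Ty] Vy]; split=> //; apply: (TT) => //; apply: TT => //.
  by case: Ee.
exists E, e; suff [c [[Ec Vc] Vcc]] : exists c, n e c /\ ~ V (c * (e * b) * (e * b)).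
  by exists c; split=> //; [move=> y [] | split=> //; apply: nE].
(* Without such a [c], multiplication by [e * b] preserves [n e], and integrality forces [e * b]
   into [V]. *)
apply: contrapT => noc; apply: Veb.
have [l2 [l2n ngen]] := sat_noeth_gen nG GM EG (nM e) (xn e Ee) (fun y => @proj1 _ _).
apply: (@frac_set_integral S m (n e) l2 x xi) => //.
- by apply: xn => //; exists 1; rewrite ?mulr1 //; split.
- move=> y /ngen [s [_ [w [ms [z [Vz _] <-] lw ye]]]].
  by exists s, (phi x * z), w; split=> //; exists z.
- move=> z nz; split; first exact: nE.
  by apply: contrapT => Vz; apply: noc; exists z.
Qed.

(** Reduction to [noeth_transform]: [b] is replaced by a multiple whose ideal of denominators in [A]
    is maximal among the proper ones, hence prime, and [S'] adjoins to [S] the complement of this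
    prime. *)
Lemma prime_transform (S : set K) x xi b :
  mult_set S -> phi x * xi = 1 -> D (phi x * b) -> ~ frac_set S b ->
  exists S' d E e c, let V := frac_set S' in let b' := e * (d * b) in
   [/\ mult_set S' /\ S `<=` S', D d, subalg phi E /\ E `<=` V, E e /\ ~ V b' &
    (forall y z, E y -> E z -> ~ V (y * b') -> ~ V (z * b') -> ~ V (y * z * b')) /\
    [/\ E c, V (c * b'), E (c * b') & ~ V (c * b' * b')]].
Proof.
move=> Smult xxi Dxb Vb.
have [SD S1 SM] := Smult; have [[D0 DD DZ] D1 DM] := subalg_integral phi.
have [[V0 VD VZ] V1 VV] := subalg_frac_set Smult.
have [||m [[c [Dc Vcb] mE] maxc]] := @noetherian_max A
  [set I | exists2 c, D c /\ ~ frac_set S (c * b) &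
    [set a | frac_set S (phi a * (c * b))] = I] noethA.
- by exists [set a | frac_set S (phi a * (1 * b))], 1; rewrite ?mul1r.
- move=> _ [c _ <-]; split=> /=.
  + by rewrite rmorph0 mul0r.
  + by move=> u v Vu Vv; rewrite rmorphD mulrDl; apply: VD.
  + by move=> u v Vv; rewrite rmorphM -mulrA; apply: VZ.
have midl : is_ideal m.
  rewrite -mE; split=> /=.
  + by rewrite rmorph0 mul0r.
  + by move=> u v Vu Vv; rewrite rmorphD mulrDl; apply: VD.
  + by move=> u v Vv; rewrite rmorphM -mulrA; apply: VZ.
have mV a : m a = frac_set S (phi a * (c * b)) by rewrite -mE.
have mP : is_prime m.
  split=> //; first by rewrite mV rmorph1 mul1r.
  move=> u v muv; apply: contrapT => /not_orP[mu]; apply.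
  apply: (maxc [set a | frac_set S (phi a * (phi u * c * b))]).
  - exists (phi u * c) => //; split; first exact: DZ.
    by rewrite -mulrA -mV.
  - move=> a; rewrite mV => /(VZ u); rewrite (_ : _ * _ = phi a * (phi u * c * b)) //.
    ring.
  - move: muv; rewrite mV (_ : _ * _ = phi v * (phi u * c * b)) //.
    by rewrite rmorphM; ring.
pose S' := [set y | exists t s, [/\ S t, ~ m s & y = t * phi s]].
have S'mult : mult_set S'.
  split.
  - by move=> _ [t [s [St _ ->]]]; apply: DM; [apply: SD | apply: integral_image].
  - by exists 1, 1; rewrite rmorph1 mulr1; split=> //; apply: prime_compl1.
  - move=> _ _ [t [s [St ms ->]]] [t' [s' [St' ms' ->]]].
    exists (t * t'), (s * s'); rewrite rmorphM mulrACA.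
    by split=> //; [apply: SM | apply: prime_complM].
have SS' : S `<=` S'.
  by move=> t St; exists t, 1; rewrite rmorph1 mulr1; split=> //; apply: prime_compl1.
have [_ mD mM] := midl; have [m0 _ _] := midl.
have [||l [lmb mbl]] := @noeth_lspan _ _ phi noethA [:: c * b] [set phi a * (c * b) | a in m].
- split.
  + by exists 0; rewrite // rmorph0 mul0r.
  + by move=> _ _ [u mu <-] [v mv <-]; exists (u + v); rewrite ?rmorphD ?mulrDl //; apply: mD.
  + by move=> u _ [v mv <-]; exists (u * v); rewrite ?rmorphM ?mulrA //; apply: mM.
- move=> _ [a _ <-]; have [_ _ Z] := submod_lspan phi [:: c * b].
  by apply: Z; apply: mem_lspan; apply: mem_head.
(* One [t] in [S] clears the denominators of the generators, so [m (t c b)] lies in [D]. *)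
have [|t St tl] := @frac_set_common S Smult l.
  by move=> _ /lmb [a ma <-]; rewrite -mV.
have [|||||E [e [c' [Ealg EV [Ee Veb] nP [Ec Vc Ecb Vcb']]]]] :=
    @noeth_transform S' m x xi (t * c * b) S'mult mP.
- by move=> s ms; exists 1, s; rewrite mul1r.
- rewrite mV mulrCA; apply: (frac_set_sub Smult).
  exact: DM.
- exact: xxi.
- move=> a ma; rewrite (_ : _ * _ = t * (phi a * (c * b))); last by ring.
  apply: (@lspan_sub _ _ phi l [set w | D (t * w)]).
  + by apply: submod_mul; split.
  + exact: tl.
  + by apply: mbl; exists a.
(* A denominator of [t c b] in [S'] involves some [s] outside [m] with [s c b] in [frac_set S],
   contrary to the choice of [m]. *)
- move=> [_ [u [s [Su ms ->]]] Du]; apply: ms; rewrite mV.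
  exists (u * t); first exact: SM.
  by rewrite (_ : _ * _ = u * phi s * (t * c * b)) //; ring.
by exists S', (t * c), E, e, c'; split=> //; apply: DM => //; apply: SD.
Qed.

End IntegrallyClosed.

(** * A prime of the integral closure inside a given prime *)

Lemma val_integral (A : comPzRingType) (d : integral_closure A) :
  integral tofrac (val d).
Proof. by have /asboolP := valP d. Qed.

Lemma integral_val (A : comPzRingType) (y : total_frac A) :
  integral tofrac y -> exists d : integral_closure A, val d = y.
Proof.
move=> iy; have yP : y \in [pred x | `[< integral tofrac x >]] by apply/asboolP.
by exists (IntegralClosure yP).
Qed.

Lemma integral_closure_prime (A : comPzRingType) (P : set (integral_closure A))
    (b : total_frac A) :
  noetherian A -> is_prime P ->
  (forall d d' : integral_closure A, val d * b = val d' -> P d) ->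
  exists p c d, [/\ is_prime p, p `<=` P, p c, ~ p d & val c * b = val d].
Proof.
move=> noethA PP Pb.
have iA := subalg_integral (@tofrac A); have [[_ _ iZ] i1 iM] := iA.
pose S := [set y | exists2 t : integral_closure A, ~ P t & val t = y].
have Smult : mult_set tofrac S.
  split.
  - by move=> _ [t _ <-]; apply: val_integral.
  - by exists 1; rewrite ?rmorph1 //; case: PP.
  - by move=> _ _ [s Ps <-] [t Pt <-]; exists (s * t); rewrite ?rmorphM //; apply: prime_complM.
have [a [x [xreg bx]]] := tofrac_surj b.
have [xi xxi] := tofrac_unit xreg.
have Vb : ~ frac_set tofrac S b.
  move=> [_ [t Pt <-] /integral_val [d' dE]]; apply: Pt.
  exact: Pb (esym dE).
have [|S' [d [E [e [c [[[S'D S'1 S'M] SS'] Dd [Ealg EV] [Ee Vb'] [nP [Ec Vc Ecb Vcb]]]]]]]] :=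
   prime_transform noethA Smult xxi _ Vb.
  by rewrite mulrC bx; apply: integral_image.
set b' := e * (d * b) in Vb' nP Vc Ecb Vcb.
have S'mult : mult_set tofrac S' by split.
set V := frac_set tofrac S' in EV Vb' nP Vc Vcb.
have Valg : subalg tofrac V := subalg_frac_set S'mult.
have [[V0 VD VZ] V1 VV] := Valg.
pose I := [set u : integral_closure A | V (val u * b')].
(* [W] is multiplicative by the primality [nP]. It contains the complement of [P], so a prime
   avoiding it lies in [P]. *)
pose W := [set u : integral_closure A | exists t y, [/\ S' t, E y, ~ V (y * b') & val u = t * y]].
have [||||p [pP Ip pW]] := @prime_disjoint _ I W.
- split=> /=.
  + by rewrite /I /= mul0r.
  + by move=> u v Vu Vv; rewrite /I /= mulrDl; apply: VD.
  + move=> u v Vv; rewrite /I /= -mulrA; apply: VV => //.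
    by apply: (frac_set_sub S'mult); apply: val_integral.
- by exists 1, 1; rewrite rmorph1 !mul1r; split=> //; case: Ealg.
- move=> u v [t [y [St Ey Vy ue]]] [t' [y' [St' Ey' Vy' ve]]].
  exists (t * t'), (y * y'); split; [exact: S'M | | exact: nP |].
    by case: Ealg => _ _; apply.
  by rewrite [val (u * v)]rmorphM /= ue ve mulrACA.
- move=> u Vu [t [y [St Ey Vy ue]]]; apply: Vy.
  by apply: (frac_set_div S'mult St); rewrite mulrA -ue.
have [t St tl] : exists2 t, S' t & forall y, y \in [:: c; c * b'; e] -> integral tofrac (t * y).
  apply: frac_set_common => // y; rewrite !inE => /or3P[] /eqP ->; exact: EV.
have [|tc tcE] := integral_val (tl c _); first by rewrite inE eqxx.
have [|ts tsE] := integral_val (tl (c * b') _); first by rewrite !inE eqxx orbT.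
have [|te teE] := integral_val (tl e _); first by rewrite !inE eqxx !orbT.
have [t' t'E] := integral_val (S'D t St).
have [d' d'E] := integral_val Dd.
have pt' : ~ p t'.
  by move/pW; apply; exists t, 1; rewrite mulr1 mul1r; split=> //; case: Ealg.
have pts : ~ p ts by move/pW; apply; exists t, (c * b').
have [[_ _ pM] _ _] := pP.
(* As [b' = e * (d * b)], multiplying [te * d' * tc] by [b] gives [t * (t * (c * b'))]. Here [tc]
   lies in [I], while [t'] and [ts] lie in [W]. *)
exists p, (te * d' * tc), (t' * ts); split=> //.
- move=> u pu; apply: contrapT => Pu; apply: (pW u pu).
  exists (val u), 1; rewrite mulr1 mul1r; split=> //.
    by apply: SS'; exists u.
  by case: Ealg.
- apply: (pM); apply: Ip; rewrite /I /= tcE -mulrA; apply: VV => //.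
  exact: (frac_set_sub S'mult (S'D t St)).
- exact: prime_complM.
- rewrite !rmorphM /= teE d'E tcE t'E tsE /b'; ring.
Qed.

(** * Flatness of overrings *)

Section LocalFractions.
Variables (A B : comPzRingType) (f : {rmorphism A -> B}).
Hypothesis f_inj : injective f.
Hypothesis f_loc : forall (b : B) (Q : set B), is_prime Q ->
  exists d d', f d * b = f d' /\ ~ Q (f d).

Notation M := (restrict_scalars f).
Implicit Types N : lmodType A.

(* num d s z says that d is a common denominator of the first components of s
   and that d times the tensor represented by s is the image of z. *)
Fixpoint num (N : lmodType A) (d : A) (s : seq (M * N)) (z : N) : Prop :=
  if s is p :: s' then
    exists d' z', [/\ f d * (p.1 : B) = f d', num d s' z' & z = d' *: p.2 + z']
  else z = 0.

Lemma num_inj N d (s : seq (M * N)) z w : num d s z -> num d s w -> z = w.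
Proof.
elim: s z w => [z w -> -> //|p s IH z w [c [z' [cE nz ->]]] [c' [w' [c'E nw ->]]]].
by rewrite (IH _ _ nz nw); congr (_ *: _ + _); apply: f_inj; rewrite -cE.
Qed.

Lemma num_scale N d e (s : seq (M * N)) z : num d s z -> num (e * d) s (e *: z).
Proof.
elim: s z => [z ->|p s IH z [c [z' [cE nz ->]]]] /=; first by rewrite scaler0.
exists (e * c), (e *: z'); split; last by rewrite scalerDr scalerA.
  by rewrite !rmorphM -mulrA cE.
exact: IH.
Qed.

Lemma num_cat N d (s t : seq (M * N)) z w :
  num d s z -> num d t w -> num d (s ++ t) (z + w).
Proof.
move=> + nw; elim: s z => [z -> /=|p s IH z [c [z' [cE nz ->]]]] /=.
  by rewrite add0r.
by exists c, (z' + w); split; [|exact: IH|rewrite addrA].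
Qed.

Lemma num_ex N (s : seq (M * N)) Q : is_prime Q -> exists d z, num d s z /\ ~ Q (f d).
Proof.
move=> QP; elim: s => [|p s [e [w [nw Qe]]]].
  by exists 1, 0; split=> //; rewrite rmorph1; case: QP.
have [d [d' [dE Qd]]] := f_loc (p.1 : B) QP.
exists (d * e), ((e * d') *: p.2 + d *: w); split; last first.
  by rewrite rmorphM; apply: prime_complM.
exists (e * d'), (d *: w); split=> //; last exact: num_scale.
by rewrite !rmorphM -dE; ring.
Qed.

(** After localization at [Q] the tensor product becomes a localization of [N], where a formal sum
    becomes the fraction [z / d]; the generating relations preserve this fraction. *)
Lemma num_tensor_eq N (s t : seq (M * N)) Q : Tensor.tensor_eq s t -> is_prime Q ->
  exists d z, [/\ num d s z, num d t z & ~ Q (f d)].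
Proof.
move=> st QP; elim: st => {s t}.
- by move=> s; have [d [z [nz Qd]]] := num_ex s QP; exists d, z.
- by move=> s t _ [d [z [nz nz' Qd]]]; exists d, z.
- move=> s t u _ [d [z [nz nz' Qd]]] _ [e [w [nw nw' Qe]]].
  (* Both are the numerator of the middle sum [t] over the denominator [e * d]. *)
  have eq_zw : e *: z = d *: w.
    by apply: (@num_inj _ (e * d) t); [|rewrite mulrC]; apply: num_scale.
  exists (e * d), (e *: z); split; first exact: num_scale.
    by rewrite eq_zw mulrC; apply: num_scale.
  by rewrite rmorphM; apply: prime_complM.
- move=> s s' t t' _ [d [z [nz nz' Qd]]] _ [e [w [nw nw' Qe]]].
  exists (e * d), (e *: z + d *: w); split.
  + by apply: num_cat; [|rewrite mulrC]; apply: num_scale.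
  + by apply: num_cat; [|rewrite mulrC]; apply: num_scale.
  + by rewrite rmorphM; apply: prime_complM.
- move=> s t; have [d [z [nz Qd]]] := num_ex s QP; have [e [w [nw Qe]]] := num_ex t QP.
  exists (e * d), (e *: z + d *: w); split.
  + by apply: num_cat; [|rewrite mulrC]; apply: num_scale.
  + by rewrite addrC; apply: num_cat; [rewrite mulrC|]; apply: num_scale.
  + by rewrite rmorphM; apply: prime_complM.
- move=> n; exists 1, 0; split=> //; last by rewrite rmorph1; case: QP.
  exists 0, 0; split=> //=; last by rewrite scale0r addr0.
  by rewrite rmorph0 mulr0.
- move=> m m' n; have [d [z [nz Qd]]] := num_ex [:: (m, n); (m', n)] QP.
  exists d, z; split=> //.
  have [c [_ [cE [c' [_ [c'E -> ->]]] ->]]] := nz.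
  exists (c + c'), 0; split=> //=; last by rewrite scalerDl addrA.
  by rewrite rmorphD -cE -c'E mulrDr.
- move=> m n n'; have [d [d' [dE Qd]]] := f_loc (m : B) QP.
  exists d, (d' *: (n + n') + 0); split=> //=; first by exists d', 0.
  exists d', (d' *: n'); split=> //; last by rewrite scalerDr addr0.
  by exists d', 0; split=> //; rewrite addr0.
- move=> a m n; have [d [d' [dE Qd]]] := f_loc (m : B) QP.
  exists d, (d' *: (a *: n) + 0); split=> //=; last by exists d', 0.
  exists (a * d'), 0; split=> //=; last by rewrite scalerA mulrC.
  change (f d * (f a * (m : B)) = f (a * d')).
  by rewrite mulrCA dE rmorphM.
Qed.

Lemma num_map N N' (u : {linear N -> N'}) d (s : seq (M * N)) z :
  num d (Tensor.map_sum u s) z -> exists2 w, num d s w & z = u w.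
Proof.
elim: s z => [z -> /=|p s IH z [c [z' [cE /IH [w nw ->] ->]]]].
  by exists 0; rewrite ?linear0.
by exists (c *: p.2 + w); [exists c, w | rewrite linearD linearZ].
Qed.

Lemma pureDl N (m m' : M) (n : N) :
  Tensor.pure (m + m') n = Tensor.pure m n + Tensor.pure m' n.
Proof.
rewrite /Tensor.pure (iffRL (Tensor.piP _ _) (Tensor.TensorDl m m' n)).
by rewrite !Tensor.pi_sum !big_cons !big_nil /= !addr0.
Qed.

Lemma pureDr N (m : M) (n n' : N) :
  Tensor.pure m (n + n') = Tensor.pure m n + Tensor.pure m n'.
Proof.
rewrite /Tensor.pure (iffRL (Tensor.piP _ _) (Tensor.TensorDr m n n')).
by rewrite !Tensor.pi_sum !big_cons !big_nil /= !addr0.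
Qed.

Lemma pureZ N a (m : M) (n : N) : Tensor.pure (a *: m) n = Tensor.pure m (a *: n).
Proof. exact/Tensor.piP/Tensor.TensorZ. Qed.

Lemma pure_scale N a (m : M) (n : N) : Tensor.pure (a *: m) n = a *: Tensor.pure m n.
Proof.
change (Tensor.pure (a *: m) n = Tensor.scale a (Tensor.pure m n)).
by rewrite /Tensor.pure Tensor.scale_pi.
Qed.

Lemma pure0 N (n : N) : Tensor.pure (0 : M) n = 0.
Proof. by rewrite -(scale0r (0 : M)) pure_scale scale0r. Qed.

(** The annihilator in [B] of a tensor killed by the induced map lies in no prime of [B], hence
    contains [1]. *)
Lemma flat_local_fractions : flat M.
Proof.
move=> N N' u u_inj x y mxy; apply/eqP; rewrite -subr_eq0; apply/eqP.
have : Tensor.map M u (x - y) = 0.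
  have := Tensor.map_is_linear u (-1) y x.
  by rewrite !scaleN1r [- y + x]addrC => ->; rewrite mxy addNr.
move: (x - y); elim/quotW => s ms0 {x y mxy}.
have ts : Tensor.tensor_eq (Tensor.map_sum u s) [::].
  by apply/Tensor.piP; rewrite -Tensor.map_pi; apply: ms0.
(* [act b] is [b] times the class of [s], for the [B]-module structure of the tensor product. *)
pose act (b : B) : Tensor.type M N := \sum_(p <- s) Tensor.pure ((b * (p.1 : B)) : M) p.2.
have actD b c : act (b + c) = act b + act c.
  by rewrite -big_split /=; apply: eq_bigr => p _; rewrite -pureDl mulrDl.
have actM b c : act c = 0 -> act (b * c) = 0.
  move=> c0.
  (* [h] is multiplication by [b] on the whole tensor product. *)
  have [||||h [hE _]] := @Tensor.universal A M N (Tensor.type M N)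
    (fun m n => Tensor.pure ((b * (m : B)) : M) n).
  - by move=> n m m'; rewrite -pureDl -mulrDr.
  - by move=> m n n'; rewrite pureDr.
  - move=> a m n; rewrite -pure_scale; congr Tensor.pure.
    by rewrite -[LHS]/(b * (f a * (m : B))) mulrCA.
  - by move=> a m n; rewrite -pureZ pure_scale.
  rewrite -(linear0 h) -c0 linear_sum; apply: eq_bigr => p _.
  by rewrite hE mulrA.
have act1 : \pi_(Tensor.type M N) s = act 1.
  by rewrite Tensor.pi_sum; apply: eq_bigr => p _; rewrite mul1r.
have actE d z : num d s z -> act (f d) = Tensor.pure ((1 : B) : M) z.
  rewrite /act; elim: (s) z => [z ->|p s' IH z [c [z' [cE nz ->]]]].
    by rewrite big_nil -(scale0r (0 : N)) -pureZ scale0r pure0.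
  rewrite big_cons (IH _ nz) pureDr -pureZ; congr (Tensor.pure _ _ + _).
  by rewrite cE -[RHS]/(f c * 1) mulr1.
rewrite act1; apply: contrapT => act1n0.
have [||||Q [QP actQ _]] := @prime_disjoint B [set b | act b = 0] [set 1].
- split=> /=; first by rewrite /act big1 // => p _; rewrite mul0r pure0.
    by move=> b c b0 c0; rewrite actD b0 c0 addr0.
  by move=> b c; apply: actM.
- by [].
- by move=> b c -> -> /=; rewrite mulr1.
- by move=> b b0 b1; apply: act1n0; rewrite -b1.
(* The image of [s] is zero, so its numerator [z] vanishes; injectivity of [u] then kills the
   numerator [w] of [s], and [f d] annihilates the class. *)
have [d [z [nz z0 Qd]]] := num_tensor_eq ts QP.
apply: Qd; apply: actQ => /=.
have [w nw wE] := num_map nz.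
rewrite (actE d w nw).
have -> : w = 0 by apply: u_inj; rewrite linear0 -wE.
by rewrite -(scale0r (0 : N)) -pureZ scale0r pure0.
Qed.

End LocalFractions.

(** * Perinormality of the integral closure *)

Lemma is_prime_preimage (A B : comPzRingType) (f : {rmorphism A -> B}) (Q : set B) :
  is_prime Q -> is_prime (f @^-1` Q).
Proof.
move=> [[Q0 QD QM] Q1 QP]; split; [split| |] => /=.
- by rewrite /preimage /= rmorph0.
- by move=> x y Qx Qy; rewrite /preimage /= rmorphD; apply: QD.
- by move=> a x Qx; rewrite /preimage /= rmorphM; apply: QM.
- by rewrite rmorph1.
- by move=> x y; rewrite rmorphM; apply: QP.
Qed.

(** Overrings of the integral closure live in its own total quotient ring; [y] realizes the fraction
    [u / v] in that of [A]. If [v = a / s], then [a] is regular in [A], so [v] has the inverse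
    [s / a]. *)
Lemma total_frac_integral_closure (A : comPzRingType)
    (u v : integral_closure A) : GRing.lreg v ->
  exists y : total_frac A,
    forall d d' : integral_closure A, val d * y = val d' -> d * u = d' * v.
Proof.
move=> vreg.
have [a [s [sreg vs]]] := tofrac_surj (val v).
have inA (c : A) : exists d : integral_closure A, val d = tofrac c.
  by apply: integral_val; apply: integral_image.
have areg : GRing.lreg a.
  move=> b c abc; apply: sreg; have [sb sbE] := inA (s * b); have [sc scE] := inA (s * c).
  apply: (@tofrac_inj A); rewrite -sbE -scE; congr val; apply: vreg; apply: val_inj.
  by rewrite !rmorphM /= sbE scE !rmorphM !mulrA vs -!rmorphM /= abc.
have [w wE] := tofrac_unit areg.
have vinv : val v * (tofrac s * w) = 1 by rewrite mulrA vs.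
exists (val u * (tofrac s * w)).
move=> d d' dE; apply: val_inj; rewrite !rmorphM /= -dE.
transitivity (val d * val u * (val v * (tofrac s * w))); first by rewrite vinv mulr1.
by rewrite /=; ring.
Qed.

Theorem corollary12 (A : comPzRingType) :
  reduced A -> noetherian A -> perinormal (integral_closure A).
Proof.
move=> _ noethA B f [g g_inj gf] gd.
apply: flat_local_fractions.
  by move=> x y fxy; apply: tofrac_inj; rewrite -!gf fxy.
move=> b Q QP; apply: contrapT => noloc.
have [u [v [vreg gb]]] := tofrac_surj (g b).
have bv : b * f v = f u by apply: g_inj; rewrite rmorphM !gf.
have [y yP] := total_frac_integral_closure u vreg.
(* [y] represents [b = u / v], so a relation for [y] in [total_frac A] transfers to [b]. *)
have fy d d' : val d * y = val d' -> f d * b = f d'.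
  move=> /yP duv; apply: g_inj; have [w vw] := tofrac_unit vreg.
  rewrite -[LHS]mulr1 -[RHS]mulr1 -vw !mulrA -gf -!rmorphM /=.
  by rewrite -mulrA bv -!rmorphM duv.
have [|p [c [d [pP pQ pc pd cd]]]] :=
  @integral_closure_prime A _ y noethA (is_prime_preimage f QP).
  move=> d d' /fy db; apply: contrapT => Qd; apply: noloc.
  by exists d, d'.
(* Going down lifts [p] to [Q1]; since [f c] lies in [Q1], so does [f c * b = f d], which puts [d]
   in [p]. *)
have [Q1 [[[_ _ Q1M] _ _] _ Q1p]] := gd p _ pP (is_prime_preimage f QP) pQ Q QP erefl.
apply: pd; rewrite -Q1p /preimage /= -(fy _ _ cd) mulrC; apply: Q1M.
by move: pc; rewrite -Q1p.
Qed.
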